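(* Let $T>0$, let $p:\mathbb{R}\to\mathbb{R}^2$ be continuous and $T$-periodic with average $\overline p:=\frac1T\int_0^T p(t)\,dt$, and let $g=\nabla G$, where $G:\mathbb{R}^2\to\mathbb{R}$ is continuously differentiable (no boundedness of $g$ is assumed). Suppose that $g(u)\neq\overline p$ for all $u$ with $|u|$ sufficiently large, and that the limits $$q_v:=\lim_{r\to+\infty}\frac{g(rv)-\overline p}{|g(rv)-\overline p|}$$ exist uniformly for $v$ in the unit circle $\partial B\subset\mathbb{R}^2$. Let $\Gamma_q(\theta):=q_{v(\theta)}$ for $\theta\in[0,2\pi]$, where $v(\theta)=e^{i\theta}=(\cos\theta,\sin\theta)$. Assume that 1. $q_v\neq 0$ for all $v\in\partial B$; 2. $I(\Gamma_q,0)\neq 0$. Then the system $$u'(t)+\nabla G(u(t))=p(t)$$ has at least one $T$-periodic solution $u:\mathbb{R}\to\mathbb{R}^2$.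
   Context: $\mathbb{R}^2$ is identified with $\mathbb{C}$; $|\cdot|$ is the Euclidean norm; $B$ is the open unit ball of $\mathbb{R}^2$ and $\partial B$ is the unit circle. For a continuous closed curve $\gamma:[0,2\pi]\to\mathbb{R}^2$ and a point $z_0$ not on its image, $I(\gamma,z_0)$ denotes the winding number of $\gamma$ around $z_0$. The uniformity of the limits defining $q_v$ makes $\Gamma_q$ a continuous closed curve. A $T$-periodic solution is a continuously differentiable $u:\mathbb{R}\to\mathbb{R}^2$ satisfying the system for all $t$ and $u(t+T)=u(t)$ for all $t$. *)

(* Defs.v *)
From Stdlib Require Import Reals Lra Lia ZArith.
From Stdlib Require Import ClassicalEpsilon.
From Coquelicot Require Import Coquelicot.

Open Scope R_scope.

(* The plane is Coquelicot's [C = R * R], and [Cmod] is the Euclidean norm.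
   Differentials, derivatives and integrals are taken over the real scalars,
   hence the explicit [C_R_...] structures: the canonical normed module on [C]
   is the one over the complex scalars. *)

Definition cis (theta : R) : C := (cos theta, sin theta).

(* Coquelicot's [continuous_on D] is continuity relative to [D]: one-sided at
   the end points. *)
Definition seg : R -> Prop := fun t => 0 <= t <= 2 * PI.

Definition periodic (T : R) (f : R -> C) : Prop := forall t, f (t + T) = f t.

Definition average (T : R) (p : R -> C) : C :=
  (RtoC (/ T) * RInt (V := C_R_CompleteNormedModule) p 0 T)%C.

Definition gradient (G : C -> R) (z : C) : C :=
  (Derive (fun x => G (x, Im z)) (Re z), Derive (fun y => G (Re z, y)) (Im z)).

Definition continuously_differentiable (G : C -> R) : Prop :=
  (forall z : C,
     ex_filterdiff (U := C_R_NormedModule) (V := R_NormedModule) G (locally z))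
  /\ (forall z : C, continuous (gradient G) z).

(* [w / |w|], meaningful only for [w <> 0]. *)
Definition direction (w : C) : C := (w / RtoC (Cmod w))%C.

(* [F r v --> q v] as [r --> +oo], uniformly for [v] in the unit circle. *)
Definition uniform_radial_limit (F : R -> C -> C) (q : C -> C) : Prop :=
  forall eps : R, 0 < eps ->
    exists r0 : R, forall (r : R) (v : C),
      r0 < r -> Cmod v = 1 -> Cmod (F r v - q v)%C < eps.

(* A continuous determination of the angle of [gamma - z0] along [0, 2 pi]
   increases by [2 pi k]. *)
Definition is_winding_number (gamma : R -> C) (z0 : C) (k : Z) : Prop :=
  (forall t, seg t -> gamma t <> z0) /\
  exists theta : R -> R,
    continuous_on seg theta /\
    (forall t, seg t ->
       (gamma t - z0 = RtoC (Cmod (gamma t - z0)) * cis (theta t))%C) /\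
    theta (2 * PI) - theta 0 = 2 * PI * IZR k.

(* Every continuous closed curve that avoids [z0] has a winding number (unique
   by [winding_number_eq] below); the value 0 is a default for the curves that
   have none. *)
Definition winding_number (gamma : R -> C) (z0 : C) : Z :=
  match excluded_middle_informative (exists k, is_winding_number gamma z0 k) with
  | left h => proj1_sig (constructive_indefinite_description _ h)
  | right _ => 0%Z
  end.

Lemma is_winding_number_unique gamma z0 k1 k2 :
  is_winding_number gamma z0 k1 -> is_winding_number gamma z0 k2 -> k1 = k2.
Proof.
intros [Hne [a [ca [Ha Ea]]]] [_ [b [cb [Hb Eb]]]].
pose proof PI_RGT_0 as Hpi.
set (clamp := fun t : R => Rmax 0 (Rmin t (2 * PI))).
assert (Hclamp : forall t, seg (clamp t)).
{ intros t; unfold seg, clamp, Rmax, Rmin.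
  destruct (Rle_dec t (2 * PI)); destruct (Rle_dec 0 _); lra. }
assert (Hid : forall t, seg t -> clamp t = t).
{ intros t [h1 h2]; unfold clamp.
  rewrite Rmin_left by lra; apply Rmax_right; lra. }
assert (Hlip : forall s t, Rabs (clamp s - clamp t) <= Rabs (s - t)).
{ intros s t; unfold clamp, Rmax, Rmin, Rabs.
  destruct (Rle_dec s (2 * PI)); destruct (Rle_dec t (2 * PI));
  repeat (match goal with |- context [Rle_dec ?x ?y] => destruct (Rle_dec x y) end);
  repeat (match goal with |- context [Rcase_abs ?x] => destruct (Rcase_abs x) end); lra. }
assert (Hcont : forall f, continuous_on seg f -> continuity (fun t => f (clamp t))).
{ intros f cf t; apply continuity_pt_filterlim.
  apply (filterlim_comp _ _ _ clamp f _ (within seg (locally (clamp t)))).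
  2: exact (cf _ (Hclamp t)).
  intros P [e He]; exists e; intros s Hs; apply He; [| apply Hclamp].
  apply Rle_lt_trans with (1 := Hlip s t); exact Hs. }
set (d := fun t => a (clamp t) - b (clamp t)).
assert (Hd : continuity d) by exact (continuity_minus _ _ (Hcont a ca) (Hcont b cb)).
assert (Hcos : forall t, cos (d t) = 1).
{ intros t; pose proof (Hclamp t) as hs; set (s := clamp t) in *.
  assert (Hm : RtoC (Cmod (gamma s - z0)) <> 0%C).
  { intros h; apply (Hne s hs).
    apply RtoC_inj, Cmod_eq_0 in h.
    replace (gamma s) with (gamma s - z0 + z0)%C by ring; rewrite h; ring. }
  assert (E : cis (a s) = cis (b s)).
  { pose proof (Ha s hs) as h1; rewrite (Hb s hs) in h1 at 1.
    replace (cis (a s)) with (/ RtoC (Cmod (gamma s - z0)) *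
       (RtoC (Cmod (gamma s - z0)) * cis (a s)))%C by (field; exact Hm).
    rewrite <- h1; field; exact Hm. }
  injection E as E1 E2.
  unfold d; fold s; rewrite cos_minus, E1, E2.
  pose proof (sin2_cos2 (b s)) as h; unfold Rsqr in h; lra. }
assert (Hdiff : d (2 * PI) - d 0 = 2 * PI * IZR (k1 - k2)).
{ unfold d; rewrite !Hid by (unfold seg; lra); rewrite minus_IZR; lra. }
destruct (Z.eq_dec k1 k2) as [e | ne]; [exact e | exfalso].
assert (Hval : forall y, Rmin (d 0) (d (2 * PI)) <= y <= Rmax (d 0) (d (2 * PI)) ->
  cos y = 1).
{ intros y Hy; destruct (IVT_gen d 0 (2 * PI) y Hd Hy) as [x [_ Hx]].
  rewrite <- Hx; apply Hcos. }
assert (Hc0 : cos (d 0 + PI) = - 1 /\ cos (d 0 - PI) = - 1).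
{ rewrite cos_minus, cos_plus, cos_PI, sin_PI, Hcos; lra. }
assert (Hk : IZR (k1 - k2) >= 1 \/ IZR (k1 - k2) <= - 1).
{ destruct (Z_lt_ge_dec 0 (k1 - k2)) as [h | h].
  - left; apply Rle_ge, IZR_le; lia.
  - right; apply IZR_le; lia. }
destruct Hk as [Hk | Hk].
- assert (d (2 * PI) - d 0 >= 2 * PI) by (rewrite Hdiff; nra).
  assert (cos (d 0 + PI) = 1); [| lra].
  apply Hval; rewrite Rmin_left, Rmax_right by lra; lra.
- assert (d (2 * PI) - d 0 <= - (2 * PI)) by (rewrite Hdiff; nra).
  assert (cos (d 0 - PI) = 1); [| lra].
  apply Hval; rewrite Rmin_right, Rmax_left by lra; lra.
Qed.

Lemma winding_number_eq gamma z0 k :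
  is_winding_number gamma z0 k -> winding_number gamma z0 = k.
Proof.
intros H; unfold winding_number.
destruct (excluded_middle_informative _) as [h | h].
- destruct (constructive_indefinite_description _ h) as [k' H']; simpl.
  exact (is_winding_number_unique _ _ _ _ H' H).
- exfalso; apply h; exists k; exact H.
Qed.

Definition is_periodic_solution (T : R) (g : C -> C) (p u : R -> C) : Prop :=
  exists du : R -> C,
    (forall t, is_derive (V := C_R_NormedModule) u t (du t)) /\
    (forall t, continuous du t) /\
    (forall t, (du t + g (u t))%C = p t) /\
    periodic T u.

(* Main.v *)
Require Import Defs.
From Stdlib Require Import Reals ZArith Lra Lia Psatz.
From Stdlib Require Import ClassicalEpsilon FunctionalExtensionality.
From Coquelicot Require Import Coquelicot.
From mathcomp Require filter.

Open Scope R_scope.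

(** Subtract the mean: with [pb] the average of [p], put [g0 = gradient G - pb],
which is again a gradient, and let [Pi] be the [T]-periodic primitive of
[p - pb].  The system is [u' = Pi' - g0 (u)].

Why large periodic orbits do not exist.  Multiply [u' = lam * (Pi' - g0 (u))]
by [u'] and integrate over a period.  The gradient term integrates to zero, so
the length of [u] over a period is bounded independently of [u] and of [lam] in
[[0, 1]].  If [u (0)] is far from the origin, the whole orbit therefore sees
almost one direction [v], hence [g0 (u t)] stays close in direction to [q v]
([field_aligned_far_away]) and its integral over a period cannot vanish; but
that integral is [0], since [u] and [Pi] return to their initial values.

Why a periodic orbit exists.  Let [Phi (lam, z)] be the displacement over one
period of the solution issued from [z], divided by [- lam].  By the previous
paragraph it has no zero on a large circle [|z| = r], for every [lam] in
[[0, 1]], and its limit at [lam = 0] is [T * g0 (z)].  Deform the circle first in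
[lam] and then to its centre: if [Phi (1, .)] had no zero in the disc, the
curve [g0 (r * cis theta)], and with it [q (cis theta)], would have winding
number [0].

Since [g0] is only continuous, the flow need not be unique or global, so the
argument is run on an explicit Euler scheme with [N] steps ([drift]), where
[Phi] is continuous by construction ([continuous_drift]).  The right-hand side
is multiplied by a cutoff, which keeps the steps small.  The energy argument
survives ([energy_estimate]): truncating [Pi' - g0] as a whole, rather than [g0],
only improves the inequality.  The discrete estimate shows that the periodic
orbits in question never reach the truncated region, which gives
[drift_nonzero], [periodic_orbit_exists] and [periodic_euler_orbits].

Finally [N] tends to infinity ([euler_limit]).  The limit is taken pointwise
along an ultrafilter on the integers, which is also the tool for the other
compactness arguments; the differential equation is recovered from an
inequality between difference quotients, which passes to pointwise limits. *)

(** * Compactness along an ultrafilter *)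

(** Along such a filter every bounded sequence converges, so it plays the role of
a subsequence that works for all bounded sequences simultaneously. *)
Definition ultra (U : (nat -> Prop) -> Prop) : Prop :=
  ProperFilter U /\ (forall P, U P \/ U (fun n => ~ P n)) /\
  (forall P, eventually P -> U P).

Lemma ultra_exists : exists U, ultra U.
Proof.
assert (PF : filter.ProperFilter (T := nat) eventually).
{ constructor.
  - intros [N HN]; exact (HN N (le_n N)).
  - constructor.
    + now exists 0%nat.
    + intros P Q HP HQ; exact (filter_and P Q HP HQ).
    + intros P Q HPQ HP; exact (filter_imp P Q HPQ HP). }
destruct (filter.ultraFilterLemma PF) as [U [HU HE]].
assert (pU := @filter.ultra_proper _ _ HU).
assert (fU := @filter.filter_filter _ _ pU).
exists U; split; [| split].
- constructor.
  + intros P HP; apply NNPP; intros Hn.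
    apply (@filter.filter_not_empty _ U pU).
    apply (@filter.filterS _ U fU P); [| exact HP].
    intros n Pn; apply Hn; now exists n.
  + constructor.
    * apply (@filter.filterT _ U fU).
    * intros P Q HP HQ; exact (@filter.filterI _ U fU P Q HP HQ).
    * intros P Q HPQ HP; exact (@filter.filterS _ U fU P Q HPQ HP).
- intros P; exact (@filter.in_ultra_setVsetC _ U P HU).
- exact HE.
Qed.

(** The product uniform structure of the plane measures with the sup norm; the two
norms are equivalent. *)
Lemma filterlim_Cmod {X} (F : (X -> Prop) -> Prop) {FF : Filter F} (f : X -> C) (l : C) :
  filterlim f F (locally l) <->
  (forall eps, 0 < eps -> F (fun x => Cmod (f x - l)%C < eps)).
Proof.
assert (Hn : 0 < @norm_factor _ C_R_NormedModule) by apply norm_factor_gt_0.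
split.
- intros H eps Heps.
  assert (He : 0 < eps / @norm_factor _ C_R_NormedModule).
  { now apply Rdiv_lt_0_compat. }
  generalize (proj1 (filterlim_locally f l) H (mkposreal _ He)).
  apply filter_imp; intros x Hx.
  apply (norm_compat2 (V := C_R_NormedModule)) in Hx.
  rewrite Cmod_norm; simpl in Hx.
  replace (@norm_factor _ C_R_NormedModule * (eps / @norm_factor _ C_R_NormedModule))
    with eps in Hx by (field; lra).
  exact Hx.
- intros H; apply (proj2 (filterlim_locally f l)); intros eps.
  generalize (H eps (cond_pos eps)); apply filter_imp; intros x Hx.
  apply (norm_compat1 (V := C_R_NormedModule)).
  rewrite Cmod_norm in Hx; exact Hx.
Qed.

Lemma continuous_delta (f : C -> C) (z : C) : continuous f z ->
  forall eps, 0 < eps -> exists delta, 0 < delta /\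
  forall w, Cmod (w - z)%C < delta -> Cmod (f w - f z)%C < eps.
Proof.
intros H eps Heps.
destruct (proj1 (filterlim_Cmod _ f (f z)) H eps Heps) as [d Hd].
exists d; split; [apply cond_pos |]; intros w Hw; apply Hd.
apply (norm_compat1 (V := C_R_NormedModule)); rewrite Cmod_norm in Hw; exact Hw.
Qed.

(** The limit is the supremum of the [y] that lie below [U]-almost all terms; the
dichotomy of an ultrafilter bounds the terms from above near that supremum. *)
Lemma ultra_limit_R U (x : nat -> R) A : ultra U -> (forall n, Rabs (x n) <= A) ->
  exists l : R, filterlim x U (locally l).
Proof.
intros [PU [dich _]] HA.
assert (HA' : forall n, - A <= x n <= A) by (intros n; apply Rabs_le_between, HA).
destruct (completeness (fun y => U (fun n => y <= x n))) as [l [Hub Hlub]].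
- exists A; intros y Hy; destruct (filter_ex _ Hy) as [n Hn].
  specialize (HA' n); lra.
- exists (- A); apply filter_forall; intros n; apply HA'.
- exists l; apply (proj2 (filterlim_locally x l)); intros eps.
  assert (He := cond_pos eps).
  assert (H1 : U (fun n => l - eps < x n)).
  { apply NNPP; intros Hn.
    assert (l <= l - eps); [| lra].
    apply Hlub; intros y Hy; apply Rnot_lt_le; intros Hlt; apply Hn.
    revert Hy; apply filter_imp; intros n Hle; lra. }
  assert (H2 : U (fun n => x n < l + eps)).
  (* Otherwise [l + eps] would be one of the [y] whose supremum is [l]. *)
  { destruct (dich (fun n => l + eps <= x n)) as [h | h].
    - specialize (Hub _ h); lra.
    - revert h; apply filter_imp; intros n; lra. }
  generalize (filter_and _ _ H1 H2); apply filter_imp; intros n [h1 h2].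
  apply Rabs_lt_between; unfold minus, plus, opp; simpl; lra.
Qed.

Lemma ultra_limit U (z : nat -> C) A : ultra U -> (forall n, Cmod (z n) <= A) ->
  exists l : C, filterlim z U (locally l).
Proof.
intros HU HA; pose proof HU as [PU _].
assert (Hb : forall n, Rabs (fst (z n)) <= A /\ Rabs (snd (z n)) <= A).
{ intros n; pose proof (Rmax_Cmod (z n)); specialize (HA n).
  pose proof (Rmax_l (Rabs (fst (z n))) (Rabs (snd (z n)))).
  pose proof (Rmax_r (Rabs (fst (z n))) (Rabs (snd (z n)))). lra. }
destruct (ultra_limit_R U (fun n => fst (z n)) A HU (fun n => proj1 (Hb n))) as [a Ha].
destruct (ultra_limit_R U (fun n => snd (z n)) A HU (fun n => proj2 (Hb n))) as [b Hl].
exists (a, b); apply (proj2 (filterlim_locally z (a, b))); intros eps.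
generalize (filter_and _ _ (proj1 (filterlim_locally _ a) Ha eps)
                           (proj1 (filterlim_locally _ b) Hl eps)).
apply filter_imp; intros n Hn; exact Hn.
Qed.

Lemma continuous_Cmod (z : C) : continuous (fun w : C => Cmod w) z.
Proof.
apply (continuous_ext (fun w : C_R_NormedModule => norm w)).
- intros w; symmetry; apply Cmod_norm.
- apply (filterlim_norm (V := C_R_NormedModule)).
Qed.

Lemma closed_disc A : closed (fun z : C => Cmod z <= A).
Proof. exact (closed_comp _ _ continuous_Cmod (closed_le A)). Qed.

Lemma closed_circle A : closed (fun z : C => Cmod z = A).
Proof. exact (closed_comp _ _ continuous_Cmod (closed_eq A)). Qed.

(** Only [z] is required to lie in [K], so that continuity at the points of [K] is
enough although [w] ranges over a neighbourhood of [K]. *)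
Lemma uniformly_continuous_on_compact (K : C -> Prop) (f : C -> C) A :
  closed K -> (forall z, K z -> Cmod z <= A) -> (forall z, K z -> continuous f z) ->
  forall eps, 0 < eps -> exists delta, 0 < delta /\
  forall z w, K z -> Cmod (w - z)%C < delta -> Cmod (f w - f z)%C < eps.
Proof.
intros HK HA Hf eps Heps; apply NNPP; intros Hn.
assert (Hc : forall n : nat, exists zw : C * C, K (fst zw) /\
  Cmod (snd zw - fst zw)%C < / (INR n + 1) /\ eps <= Cmod (f (snd zw) - f (fst zw))%C).
{ intros n; apply NNPP; intros Hn'; apply Hn; exists (/ (INR n + 1)); split.
  - apply Rinv_0_lt_compat; pose proof (pos_INR n); lra.
  - intros z w Hz Hw; apply Rnot_le_lt; intros Hle; apply Hn'; exists (z, w); auto. }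
pose (zw := fun n => proj1_sig (constructive_indefinite_description _ (Hc n))).
assert (Hzw : forall n, K (fst (zw n)) /\
  Cmod (snd (zw n) - fst (zw n))%C < / (INR n + 1) /\
  eps <= Cmod (f (snd (zw n)) - f (fst (zw n)))%C).
{ intros n; exact (proj2_sig (constructive_indefinite_description _ (Hc n))). }
clearbody zw.
destruct ultra_exists as [U HU]; pose proof HU as [PU [_ HE]].
destruct (ultra_limit U (fun n => fst (zw n)) A HU) as [l Hl].
{ intros n; apply HA, Hzw. }
assert (Kl : K l).
{ apply (closed_filterlim (F := U) (fun n => fst (zw n))); [exact Hl | | exact HK].
  intros n; apply Hzw. }
destruct (continuous_delta f l (Hf l Kl) (eps / 2)) as [d [Hd Hdl]]; [lra |].
assert (H1 := proj1 (filterlim_Cmod U _ l) Hl (d / 2) ltac:(lra)).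
assert (H2 : U (fun n => / (INR n + 1) < d / 2)).
{ apply HE.
  destruct (archimed_cor1 (d / 2)) as [N [HN HN0]]; [lra |].
  exists N; intros n Hle; apply Rle_lt_trans with (2 := HN).
  apply Rinv_le_contravar; [now apply lt_0_INR |].
  apply le_INR in Hle; lra. }
destruct (filter_ex _ (filter_and _ _ H1 H2)) as [n [h1 h2]].
destruct (Hzw n) as [_ [h3 h4]].
assert (h5 : Cmod (snd (zw n) - l)%C < d).
{ replace (snd (zw n) - l)%C with ((snd (zw n) - fst (zw n)) + (fst (zw n) - l))%C by ring.
  eapply Rle_lt_trans; [apply Cmod_triangle | lra]. }
assert (h6 := Hdl _ h5).
assert (h7 : Cmod (fst (zw n) - l)%C < d) by lra.
assert (h8 := Hdl _ h7).
assert (Cmod (f (snd (zw n)) - f (fst (zw n)))%C < eps); [| lra].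
replace (f (snd (zw n)) - f (fst (zw n)))%C
  with ((f (snd (zw n)) - f l) + - (f (fst (zw n)) - f l))%C by ring.
eapply Rle_lt_trans; [apply Cmod_triangle |]; rewrite Cmod_opp; lra.
Qed.

Lemma bounded_on_disc (f : C -> C) A : (forall z, continuous f z) ->
  exists M, 0 < M /\ forall z, Cmod z <= A -> Cmod (f z) <= M.
Proof.
intros Hf; apply NNPP; intros Hn.
assert (Hc : forall n : nat, exists z : C, Cmod z <= A /\ INR n + 1 < Cmod (f z)).
{ intros n; apply NNPP; intros Hn'; apply Hn; exists (INR n + 1); split.
  - pose proof (pos_INR n); lra.
  - intros z Hz; apply Rnot_lt_le; intros Hlt; apply Hn'; exists z; auto. }
pose (z := fun n => proj1_sig (constructive_indefinite_description _ (Hc n))).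
assert (Hz : forall n, Cmod (z n) <= A /\ INR n + 1 < Cmod (f (z n))).
{ intros n; exact (proj2_sig (constructive_indefinite_description _ (Hc n))). }
clearbody z.
destruct ultra_exists as [U HU]; pose proof HU as [PU [_ HE]].
destruct (ultra_limit U z A HU) as [l Hl]; [intros n; apply Hz |].
assert (H1 := proj1 (filterlim_Cmod U _ (f l)) (filterlim_comp _ _ _ z f _ _ _ Hl (Hf l)) 1 Rlt_0_1).
assert (H2 : U (fun n => Cmod (f l) < INR n)).
{ apply HE; destruct (INR_unbounded (Cmod (f l))) as [N HN].
  exists N; intros n Hle; apply le_INR in Hle; lra. }
destruct (filter_ex _ (filter_and _ _ H1 H2)) as [n [h1 h2]].
destruct (Hz n) as [_ h3].
assert (Cmod (f (z n)) <= Cmod (f (z n) - f l)%C + Cmod (f l)); [| lra].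
replace (f (z n)) with ((f (z n) - f l) + f l)%C at 1 by ring; apply Cmod_triangle.
Qed.

(** * Limits and continuity of plane-valued maps *)

Lemma filterlim_Cplus {X} (F : (X -> Prop) -> Prop) {FF : Filter F} (f g : X -> C) (a b : C) :
  filterlim f F (locally a) -> filterlim g F (locally b) ->
  filterlim (fun x => f x + g x)%C F (locally (a + b)%C).
Proof.
intros Hf Hg; refine (filterlim_comp_2 f g Cplus Hf Hg _).
exact (filterlim_plus (V := C_R_NormedModule) a b).
Qed.

Lemma filterlim_Cminus {X} (F : (X -> Prop) -> Prop) {FF : Filter F} (f g : X -> C) (a b : C) :
  filterlim f F (locally a) -> filterlim g F (locally b) ->
  filterlim (fun x => f x - g x)%C F (locally (a - b)%C).
Proof.
intros Hf Hg; refine (filterlim_Cplus F f _ a _ Hf _).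
refine (filterlim_comp _ _ _ g Copp _ _ _ Hg _).
exact (filterlim_opp (V := C_R_NormedModule) b).
Qed.

Lemma filterlim_RtoC_mult {X} (F : (X -> Prop) -> Prop) {FF : Filter F}
  (s : X -> R) (f : X -> C) (r : R) (a : C) :
  filterlim s F (locally r) -> filterlim f F (locally a) ->
  filterlim (fun x => RtoC (s x) * f x)%C F (locally (RtoC r * a)%C).
Proof.
intros Hs Hf; rewrite <- scal_R_Cmult.
apply (filterlim_ext (fun x => scal (V := C_R_NormedModule) (s x) (f x))).
- intros x; apply scal_R_Cmult.
- refine (filterlim_comp_2 s f _ Hs Hf _).
  exact (filterlim_scal (V := C_R_NormedModule) r a).
Qed.

Lemma filterlim_bound {X} (F : (X -> Prop) -> Prop) {FF : ProperFilter F}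
  (f : X -> C) (s : X -> R) (a : C) (r : R) :
  filterlim f F (locally a) -> filterlim s F (locally r) ->
  F (fun x => Cmod (f x) <= s x) -> Cmod a <= r.
Proof.
intros Hf Hs Hle.
change (Rbar_le (Cmod a) r).
apply (filterlim_le (F := F) (fun x => Cmod (f x)) s); [exact Hle | | exact Hs].
exact (filterlim_comp _ _ _ f (fun z => Cmod z) _ _ _ Hf (continuous_Cmod a)).
Qed.

Lemma continuous_re {X : UniformSpace} (f : X -> C) x :
  continuous f x -> continuous (fun y => fst (f y)) x.
Proof. intros Hf; apply (continuous_comp f); [exact Hf | apply continuous_fst]. Qed.

Lemma continuous_im {X : UniformSpace} (f : X -> C) x :
  continuous f x -> continuous (fun y => snd (f y)) x.
Proof. intros Hf; apply (continuous_comp f); [exact Hf | apply continuous_snd]. Qed.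

Lemma continuous_pair {X : UniformSpace} (f g : X -> R) x :
  continuous f x -> continuous g x -> continuous (fun y => (f y, g y) : C) x.
Proof.
intros Hf Hg; apply (proj2 (filterlim_locally _ _)); intros eps.
generalize (filter_and _ _ (proj1 (filterlim_locally _ _) Hf eps)
                           (proj1 (filterlim_locally _ _) Hg eps)).
apply filter_imp; intros y Hy; exact Hy.
Qed.

Lemma continuous_Cplus {X : UniformSpace} (f g : X -> C) x :
  continuous f x -> continuous g x -> continuous (fun y => f y + g y)%C x.
Proof. exact (continuous_plus (V := C_R_NormedModule) f g x). Qed.

Lemma continuous_Cminus {X : UniformSpace} (f g : X -> C) x :
  continuous f x -> continuous g x -> continuous (fun y => f y - g y)%C x.
Proof. exact (continuous_minus (V := C_R_NormedModule) f g x). Qed.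

Lemma continuous_RtoC_mult {X : UniformSpace} (s : X -> R) (f : X -> C) x :
  continuous s x -> continuous f x -> continuous (fun y => RtoC (s y) * f y)%C x.
Proof.
intros Hs Hf.
apply (continuous_ext (fun y => scal (V := C_R_NormedModule) (s y) (f y))).
- intros y; apply scal_R_Cmult.
- now apply (continuous_scal (V := C_R_NormedModule)).
Qed.

Lemma continuous_cis {X : UniformSpace} (f : X -> R) x :
  continuous f x -> continuous (fun y => cis (f y)) x.
Proof.
intros Hf; apply continuous_pair; apply (continuous_comp f _ x Hf);
  apply continuity_pt_filterlim; [apply continuity_cos | apply continuity_sin].
Qed.

(** * Inner product and directions *)

Definition dot (z w : C) : R := fst z * fst w + snd z * snd w.

(** [(dot z w, cross z w)] is the complex product of the conjugate of [z] by [w]. *)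
Definition cross (z w : C) : R := fst z * snd w - snd z * fst w.

Lemma Cmod_sqr (z : C) : Cmod z * Cmod z = dot z z.
Proof.
unfold Cmod, dot; rewrite sqrt_sqrt; [ring |].
pose proof (pow2_ge_0 (fst z)); pose proof (pow2_ge_0 (snd z)); lra.
Qed.

Lemma dot_Cmod_le (z w : C) : Rabs (dot z w) <= Cmod z * Cmod w.
Proof.
assert (H : dot z w * dot z w <= (Cmod z * Cmod w) * (Cmod z * Cmod w)).
{ replace ((Cmod z * Cmod w) * (Cmod z * Cmod w))
    with ((Cmod z * Cmod z) * (Cmod w * Cmod w)) by ring.
  rewrite !Cmod_sqr; unfold dot; pose proof (Rle_0_sqr (cross z w)) as h.
  unfold Rsqr, cross in h; nra. }
pose proof (Rmult_le_pos _ _ (Cmod_ge_0 z) (Cmod_ge_0 w)).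
unfold Rabs; destruct (Rcase_abs _); nra.
Qed.

Lemma dot_real_mult_l r z w : dot (RtoC r * z)%C w = r * dot z w.
Proof. unfold dot, RtoC; simpl; ring. Qed.

Lemma dot_comm z w : dot z w = dot w z.
Proof. unfold dot; ring. Qed.

Lemma continuous_dot {X : UniformSpace} (f g : X -> C) x :
  continuous f x -> continuous g x -> continuous (fun y => dot (f y) (g y)) x.
Proof.
intros Hf Hg; unfold dot.
apply (continuous_plus (V := R_NormedModule));
  apply (continuous_mult (K := R_AbsRing));
  auto using @continuous_re, @continuous_im.
Qed.

Lemma continuous_cross {X : UniformSpace} (f g : X -> C) x :
  continuous f x -> continuous g x -> continuous (fun y => cross (f y) (g y)) x.
Proof.
intros Hf Hg; unfold cross.
apply (continuous_minus (V := R_NormedModule));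
  apply (continuous_mult (K := R_AbsRing));
  auto using @continuous_re, @continuous_im.
Qed.

Lemma Cmod_cis t : Cmod (cis t) = 1.
Proof.
unfold Cmod, cis; simpl; rewrite !Rmult_1_r.
pose proof (sin2_cos2 t) as h; unfold Rsqr in h.
rewrite Rplus_comm, h; apply sqrt_1.
Qed.

Lemma cis_closed : cis 0 = cis (2 * PI).
Proof. unfold cis; now rewrite cos_2PI, sin_2PI, cos_0, sin_0. Qed.

Lemma polar_form (w : C) : exists theta, w = (RtoC (Cmod w) * cis theta)%C.
Proof.
destruct (Req_dec (Cmod w) 0) as [h0 | h0].
{ exists 0; rewrite h0; apply Cmod_eq_0 in h0; rewrite h0; ring. }
pose proof (Cmod_ge_0 w) as hp; pose proof (Cmod_sqr w) as hw; unfold dot in hw.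
set (m := Cmod w) in *; set (x := fst w / m).
assert (hx : x * x + (snd w / m) * (snd w / m) = 1).
{ unfold x; replace 1 with ((m * m) / (m * m)) by (field; exact h0).
  rewrite hw at 1; field; exact h0. }
assert (hx1 : -1 <= x <= 1) by (split; nra).
assert (hs : sin (acos x) = Rabs (snd w / m)).
{ rewrite sin_acos by exact hx1; rewrite <- sqrt_Rsqr_abs; f_equal; unfold Rsqr; lra. }
assert (E : forall s c, x = c -> snd w / m = s -> w = (RtoC m * (c, s))%C).
{ intros s c <- <-; rewrite (surjective_pairing w) at 1.
  unfold x, RtoC, Cmult; simpl; f_equal; field; exact h0. }
destruct (Rle_dec 0 (snd w / m)) as [h | h].
- exists (acos x); apply E; [now rewrite cos_acos |].
  rewrite hs, Rabs_pos_eq; auto.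
- exists (- acos x); apply E; [rewrite cos_neg; now rewrite cos_acos |].
  rewrite sin_neg, hs, Rabs_left; lra.
Qed.

Lemma Cmod_direction (z : C) : z <> RtoC 0 -> Cmod (direction z) = 1.
Proof.
intros Hz; assert (H := proj1 (Cmod_gt_0 z) Hz).
unfold direction; rewrite Cmod_div by (intros h; apply RtoC_inj in h; lra).
rewrite Cmod_R, Rabs_pos_eq by lra; field; lra.
Qed.

Lemma direction_polar (z : C) : z <> RtoC 0 -> z = (RtoC (Cmod z) * direction z)%C.
Proof.
intros Hz; assert (H := proj1 (Cmod_gt_0 z) Hz).
unfold direction; field; intros h; apply RtoC_inj in h; lra.
Qed.

Lemma continuous_direction {X : UniformSpace} (f : X -> C) x :
  continuous f x -> f x <> RtoC 0 -> continuous (fun y => direction (f y)) x.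
Proof.
intros Hf H0; assert (H := proj1 (Cmod_gt_0 _) H0).
apply (continuous_ext_loc _ (fun y => RtoC (/ Cmod (f y)) * f y)%C).
- assert (HP : locally x (fun y => 0 < Cmod (f y))).
  { apply (continuous_comp f _ x Hf (continuous_Cmod (f x))).
    exact (open_gt 0 _ H). }
  revert HP; apply filter_imp; intros y Hy.
  change (RtoC (/ Cmod (f y)) * f y = direction (f y))%C.
  unfold direction; rewrite RtoC_inv by lra; field.
  intros h; apply RtoC_inj in h; lra.
- apply continuous_RtoC_mult; [| exact Hf].
  apply (continuous_comp (fun y => Cmod (f y)) Rinv).
  + apply (continuous_comp f _ x Hf), continuous_Cmod.
  + apply continuity_pt_filterlim, continuity_pt_inv; [apply continuity_pt_id |].
    unfold id; lra.
Qed.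

(** Moving a vector of length [r] by at most [B] turns it by at most [2 * B / r]: one
[B / r] for the displacement, another for the change of length. *)
Lemma direction_near z w B r : 0 < r -> Cmod z = r -> w <> RtoC 0 -> Cmod (w - z)%C <= B ->
  Cmod (direction w - direction z)%C <= 2 * B / r.
Proof.
intros Hr Hz Hw HB.
assert (Hw0 := proj1 (Cmod_gt_0 w) Hw).
assert (E : (direction w - direction z)%C =
  (RtoC (/ r) * (w - z) + RtoC ((r - Cmod w) / r) * direction w)%C).
{ unfold direction; rewrite Hz, RtoC_div, RtoC_minus, RtoC_inv by lra.
  field; split; intros h; apply RtoC_inj in h; lra. }
rewrite E; eapply Rle_trans; [apply Cmod_triangle |].
rewrite !Cmod_mult, !Cmod_R, Cmod_direction by exact Hw.
unfold Rdiv; rewrite Rabs_mult, (Rabs_pos_eq (/ r)) by now apply Rlt_le, Rinv_0_lt_compat.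
assert (Hir : 0 < / r) by now apply Rinv_0_lt_compat.
assert (Ha : Rabs (r - Cmod w) <= B).
{ apply Rle_trans with (2 := HB); rewrite <- Hz, <- Rabs_Ropp.
  replace (- (Cmod z - Cmod w)) with (Cmod w - Cmod z) by ring.
  rewrite !Cmod_norm; exact (norm_triangle_inv (V := C_R_NormedModule) w z). }
nra.
Qed.

Lemma dot_pos_of_close a b : Cmod a = 1 -> Cmod (b - a)%C < 1 -> 0 < dot a b.
Proof.
intros Ha Hab.
pose proof (Cmod_sqr a) as h1; rewrite Ha in h1.
pose proof (dot_Cmod_le a (b - a)%C) as h2; rewrite Ha in h2; apply Rabs_le_between in h2.
replace (dot a (b - a)%C) with (dot a b - dot a a) in h2 by (unfold dot; simpl; ring).
lra.
Qed.

Lemma dot_pos_of_directions z w : z <> RtoC 0 -> w <> RtoC 0 ->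
  Cmod (direction z - direction w)%C < 1 -> 0 < dot z w.
Proof.
intros Hz Hw H.
rewrite (direction_polar z Hz), (direction_polar w Hw).
rewrite dot_real_mult_l, dot_comm, dot_real_mult_l, dot_comm.
apply Rmult_lt_0_compat; [now apply Cmod_gt_0 |].
apply Rmult_lt_0_compat; [now apply Cmod_gt_0 |].
apply dot_pos_of_close; [now apply Cmod_direction |].
replace (direction w - direction z)%C with (- (direction z - direction w))%C by ring.
now rewrite Cmod_opp.
Qed.

(** * Winding numbers *)

(** If the vectors [a t] and [b t] always form an acute angle, that angle is the
arctangent of a continuous function, with the same value at both ends because
the curves are closed; adding it to an angle of [a] gives an angle of [b]. *)
Lemma winding_number_acute (a b : R -> C) k :
  (forall t, seg t -> continuous a t) -> (forall t, seg t -> continuous b t) ->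
  a 0 = a (2 * PI) -> b 0 = b (2 * PI) ->
  (forall t, seg t -> 0 < dot (a t) (b t)) ->
  is_winding_number a (RtoC 0) k -> is_winding_number b (RtoC 0) k.
Proof.
intros Ca Cb Ea Eb Hpos [_ [theta [Ct [Ht Hk]]]].
set (phi := fun t => cross (a t) (b t) / dot (a t) (b t)).
split.
- intros t Ht' E; specialize (Hpos t Ht'); rewrite E in Hpos.
  unfold dot, RtoC in Hpos; simpl in Hpos; lra.
- exists (fun t => theta t + atan (phi t)); split; [| split].
  + intros t Ht'.
    assert (Hphi : continuous (fun s => atan (phi s)) t).
    { apply continuous_comp.
    * apply (continuous_mult (K := R_AbsRing)); [now apply continuous_cross; auto |].
      apply (continuous_comp (fun s => dot (a s) (b s)) Rinv);
        [now apply continuous_dot; auto |].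
      apply continuity_pt_filterlim, continuity_pt_inv.
      -- apply continuity_pt_id.
      -- specialize (Hpos t Ht'); unfold id; lra.
    * apply continuity_pt_filterlim, derivable_continuous_pt, derivable_pt_atan. }
    refine (filterlim_comp_2 theta (fun s => atan (phi s)) Rplus (Ct t Ht') _
      (filterlim_plus (V := R_NormedModule) _ _)).
    refine (filterlim_filter_le_1 _ _ Hphi).
    intros P HP; revert HP; apply filter_le_within.
  + intros t Ht'.
    specialize (Hpos t Ht'); specialize (Ht t Ht').
    replace (a t - RtoC 0)%C with (a t) in Ht by (rewrite <- (Cplus_0_r (a t)) at 1; ring).
    replace (b t - RtoC 0)%C with (b t) by (rewrite <- (Cplus_0_r (b t)) at 1; ring).
    pose proof (Cmod_sqr (a t)) as Ha; pose proof (Cmod_sqr (b t)) as Hb.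
    pose proof (Cmod_ge_0 (a t)) as Pa; pose proof (Cmod_ge_0 (b t)) as Pb.
    set (d := dot (a t) (b t)) in *; set (x := cross (a t) (b t)).
    (* Lagrange's identity: [|a|^2 |b|^2] is the squared modulus of [conj a * b]. *)
    assert (Hdx : d * d + x * x = (Cmod (a t) * Cmod (b t)) * (Cmod (a t) * Cmod (b t))).
    { replace ((Cmod (a t) * Cmod (b t)) * (Cmod (a t) * Cmod (b t)))
        with ((Cmod (a t) * Cmod (a t)) * (Cmod (b t) * Cmod (b t))) by ring.
      rewrite Ha, Hb; unfold d, x, dot, cross; ring. }
    assert (Hab : 0 < Cmod (a t) * Cmod (b t)).
    { destruct (Rmult_le_pos _ _ Pa Pb) as [h | h]; [exact h |].
      rewrite <- h in Hdx; nra. }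
    assert (Hs : sqrt (1 + (phi t)²) = Cmod (a t) * Cmod (b t) / d).
    { apply Rsqr_inj; [apply sqrt_pos | apply Rlt_le, Rdiv_lt_0_compat; auto |].
      rewrite Rsqr_sqrt by (pose proof (Rle_0_sqr (phi t)); lra).
      unfold phi, Rsqr; fold d x.
      replace (Cmod (a t) * Cmod (b t) / d * (Cmod (a t) * Cmod (b t) / d))
        with ((d * d + x * x) / (d * d)) by (rewrite Hdx; field; lra).
      field; lra. }
    assert (A0 : Cmod (a t) <> 0) by (intros h; rewrite h in Hab; lra).
    assert (B0 : Cmod (b t) <> 0) by (intros h; rewrite h in Hab; lra).
    pose proof (f_equal fst Ht) as H1; pose proof (f_equal snd Ht) as H2.
    unfold cis, RtoC in H1, H2; simpl in H1, H2.
    unfold cis; rewrite cos_plus, sin_plus, cos_atan, sin_atan, Hs.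
    assert (Hc : cos (theta t) = fst (a t) / Cmod (a t)).
    { apply (Rmult_eq_reg_l (Cmod (a t))); [| exact A0]. field_simplify; [lra | exact A0]. }
    assert (Hsn : sin (theta t) = snd (a t) / Cmod (a t)).
    { apply (Rmult_eq_reg_l (Cmod (a t))); [| exact A0]. field_simplify; [lra | exact A0]. }
    rewrite Hc, Hsn; unfold phi; fold d x.
    (* [|a|^2 * b = a * (conj a * b)], by components. *)
    assert (E1 : fst (b t) * (Cmod (a t) * Cmod (a t)) = fst (a t) * d - snd (a t) * x).
    { rewrite Ha; unfold d, x, dot, cross; ring. }
    assert (E2 : snd (b t) * (Cmod (a t) * Cmod (a t)) = snd (a t) * d + fst (a t) * x).
    { rewrite Ha; unfold d, x, dot, cross; ring. }
    rewrite (surjective_pairing (b t)) at 1.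
    unfold RtoC, Cmult; simpl; f_equal.
    * apply (Rmult_eq_reg_r (Cmod (a t) * Cmod (a t))); [| nra].
      rewrite E1; field; repeat split; lra.
    * apply (Rmult_eq_reg_r (Cmod (a t) * Cmod (a t))); [| nra].
      rewrite E2; field; repeat split; lra.
  + cbv beta; replace (phi (2 * PI)) with (phi 0); [lra |].
    unfold phi; now rewrite Ea, Eb.
Qed.

(** By uniform continuity of the direction of [H], the curves of two parameters
which differ by at most [1 / N] form acute angles, and [N] steps lead from
[0] to [1].  Working with directions removes the need for a positive lower
bound of [|H|]. *)
Lemma winding_number_homotopy (H : C -> C) k :
  (forall s t, 0 <= s <= 1 -> seg t -> continuous H (s, t)) ->
  (forall s t, 0 <= s <= 1 -> seg t -> H (s, t) <> RtoC 0) ->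
  (forall s, 0 <= s <= 1 -> H (s, 0) = H (s, 2 * PI)) ->
  is_winding_number (fun t => H (0, t)) (RtoC 0) k ->
  is_winding_number (fun t => H (1, t)) (RtoC 0) k.
Proof.
intros HC H0 Hper W.
set (K := fun z : C => (0 <= fst z /\ fst z <= 1) /\ (0 <= snd z /\ snd z <= 2 * PI)).
assert (Cfst : forall z : C, continuous (fun w : C => fst w) z).
{ intros z; apply continuous_re, continuous_id. }
assert (Csnd : forall z : C, continuous (fun w : C => snd w) z).
{ intros z; apply continuous_im, continuous_id. }
assert (KC : closed K).
{ apply closed_and; apply closed_and.
  - exact (closed_comp _ _ Cfst (closed_ge 0)).
  - exact (closed_comp _ _ Cfst (closed_le 1)).
  - exact (closed_comp _ _ Csnd (closed_ge 0)).
  - exact (closed_comp _ _ Csnd (closed_le (2 * PI))). }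
destruct (uniformly_continuous_on_compact K (fun z => direction (H z))
  (sqrt 2 * (1 + 2 * PI)) KC) with (eps := 1) as [d [Hd Hu]].
{ intros [s t] [Hs Ht]; simpl in Hs, Ht.
  eapply Rle_trans; [apply Cmod_2Rmax |]; simpl.
  apply Rmult_le_compat_l; [apply sqrt_pos |].
  rewrite !Rabs_pos_eq by lra; apply Rmax_lub; lra. }
{ intros [s t] [Hs Ht]; simpl in Hs, Ht.
  apply continuous_direction; [apply HC | apply H0]; auto. }
{ lra. }
destruct (archimed_cor1 d Hd) as [N [HN HN0]].
assert (PN : 0 < INR N) by now apply lt_0_INR.
assert (Cs : forall s, 0 <= s <= 1 -> forall t, seg t -> continuous (fun t => H (s, t)) t).
{ intros s Hs t Ht; apply (continuous_comp (fun t => (s, t) : C) H); [| now apply HC].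
  apply continuous_pair; [apply continuous_const | apply continuous_id]. }
assert (Hn : forall n, (n <= N)%nat ->
  is_winding_number (fun t => H (INR n / INR N, t)) (RtoC 0) k).
{ assert (Hr : forall n, (n <= N)%nat -> 0 <= INR n / INR N <= 1).
  { intros n Hn; apply le_INR in Hn; pose proof (pos_INR n); split.
    - apply Rmult_le_pos; [lra | now apply Rlt_le, Rinv_0_lt_compat].
    - apply (Rmult_le_reg_r (INR N)); [lra |]. field_simplify; lra. }
  induction n as [| n IH]; intros Hn.
  - replace (INR 0 / INR N) with 0 by (simpl; field; lra); exact W.
  - assert (R1 := Hr n ltac:(lia)); assert (R2 := Hr (S n) Hn).
    apply (winding_number_acute (fun t => H (INR n / INR N, t))); auto with arith.
    intros t Ht; apply dot_pos_of_directions; auto.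
    set (s := INR n / INR N) in *; set (s' := INR (S n) / INR N) in *.
    apply (Hu (s', t) (s, t)); [split; auto |].
    replace ((s, t) - (s', t))%C with (RtoC (- / INR N)).
    + rewrite Cmod_R, Rabs_Ropp, Rabs_pos_eq; [exact HN |].
      now apply Rlt_le, Rinv_0_lt_compat.
    + unfold s, s'; rewrite S_INR; unfold RtoC, Cminus, Cplus, Copp; simpl; f_equal; field; lra. }
specialize (Hn N (le_n N)).
replace (INR N / INR N) with 1 in Hn by (field; lra); exact Hn.
Qed.

Lemma winding_number_const (w : C) : w <> RtoC 0 -> is_winding_number (fun _ => w) (RtoC 0) 0.
Proof.
intros Hw; split; [auto |].
destruct (polar_form w) as [theta Ht]; exists (fun _ => theta); split; [| split].
- intros t _; apply filterlim_const.
- intros t _; replace (w - RtoC 0)%C with w by (rewrite <- (Cplus_0_r w) at 1; ring); exact Ht.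
- simpl; ring.
Qed.

(** * The truncated Euler scheme *)

Definition cutoff (A : R) (z : C) : R := Rmax 0 (Rmin 1 (A + 1 - Cmod z)).

Lemma cutoff_bounds A z : 0 <= cutoff A z <= 1.
Proof.
unfold cutoff; split; [apply Rmax_l |].
apply Rmax_lub; [lra | apply Rmin_l].
Qed.

Lemma cutoff_inside A z : Cmod z <= A -> cutoff A z = 1.
Proof. intros H; unfold cutoff; rewrite Rmin_left, Rmax_right; lra. Qed.

Lemma cutoff_outside A z : A + 1 <= Cmod z -> cutoff A z = 0.
Proof. intros H; unfold cutoff; rewrite Rmin_right, Rmax_left; lra. Qed.

Lemma continuous_cutoff {X : UniformSpace} A (f : X -> C) x :
  continuous f x -> continuous (fun y => cutoff A (f y)) x.
Proof.
intros Hf.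
assert (Hc : continuous (fun y => Cmod (f y)) x).
{ apply (continuous_comp f _ x Hf), continuous_Cmod. }
apply (proj2 (filterlim_locally _ _)); intros eps.
generalize (proj1 (filterlim_locally _ _) Hc eps); apply filter_imp; intros y Hy.
change (Rabs (cutoff A (f y) - cutoff A (f x)) < eps).
change (Rabs (Cmod (f y) - Cmod (f x)) < eps) in Hy.
apply Rle_lt_trans with (2 := Hy); unfold cutoff.
unfold Rmin; destruct (Rle_dec 1 (A + 1 - Cmod (f y)));
  destruct (Rle_dec 1 (A + 1 - Cmod (f x)));
unfold Rmax, Rabs;
repeat (match goal with |- context [Rle_dec ?a ?b] => destruct (Rle_dec a b) end);
repeat (match goal with |- context [Rcase_abs ?a] => destruct (Rcase_abs a) end); lra.
Qed.

(** [N] steps of the Euler scheme for [u' = lam * cutoff * (Pi' - g)], where [D] is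
[Pi] on the grid.  The recursion stores the sum of the steps with the factor
[- lam] removed, so that the displacement over a period can be compared with
[g] down to [lam = 0], where the displacement itself vanishes.  The cutoff
multiplies the whole right-hand side, which keeps the energy estimate valid. *)
Fixpoint drift (g : C -> C) (A h : R) (D : nat -> C) (lam : R) (z : C) (k : nat) : C :=
  match k with
  | O => RtoC 0
  | S j =>
      let a := drift g A h D lam z j in
      let u := (z - RtoC lam * a)%C in
      (a + RtoC (cutoff A u) * (RtoC h * g u - (D (S j) - D j)))%C
  end.

Definition node g A h D lam z k : C := (z - RtoC lam * drift g A h D lam z k)%C.

Lemma continuous_drift {X : UniformSpace} g A h D (lam : X -> R) (z : X -> C) x k :
  (forall w, continuous g w) -> continuous lam x -> continuous z x ->
  continuous (fun y => drift g A h D (lam y) (z y) k) x.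
Proof.
intros Hg Hl Hz; induction k as [| k IH]; simpl; [apply continuous_const |].
assert (Hu : continuous (fun y => z y - RtoC (lam y) * drift g A h D (lam y) (z y) k)%C x).
{ apply continuous_Cminus; [exact Hz |]; now apply continuous_RtoC_mult. }
apply continuous_Cplus; [exact IH |].
apply continuous_RtoC_mult; [now apply continuous_cutoff |].
apply continuous_Cminus; [| apply continuous_const].
apply continuous_RtoC_mult; [apply continuous_const |].
exact (continuous_comp _ g x Hu (Hg _)).
Qed.

(** For [lam = 0] the scheme does not move, so it adds up the same value of [g]. *)
Lemma drift_frozen g A h D z k : Cmod z <= A ->
  drift g A h D 0 z k = (RtoC (INR k * h) * g z - (D k - D O))%C.
Proof.
intros Hz; induction k as [| k IH].
- simpl; rewrite Rmult_0_l; ring.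
- cbn [drift]; rewrite IH.
  replace (z - RtoC 0 * (RtoC (INR k * h) * g z - (D k - D O)))%C with z by
    (rewrite Cmult_0_l; unfold Cminus; rewrite Copp_0; now rewrite Cplus_0_r).
  rewrite cutoff_inside by exact Hz; rewrite S_INR.
  rewrite Rmult_plus_distr_r, Rmult_1_l, RtoC_plus; ring.
Qed.

(** * Energy estimate *)

(** All that is used of [g] being the gradient of [G]. *)
Definition mean_value (G : C -> R) (g : C -> C) : Prop :=
  forall a b : C, exists c : C,
    Cmod (c - a)%C <= Cmod (b - a)%C /\ G b - G a = dot (g c) (b - a)%C.

(** One step [u -> u - lam * f] pays for its length with potential.  Since the cutoff
is between [0] and [1], [|f|^2 <= dot (h * g u - e) f], and by the mean value
property [lam * dot (g u) f] is the drop of [G] up to [lam * |f|], because [g]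
varies by less than [1] along the step.  This yields [|f|^2 - c * |f|] on the
left; replacing it by the smaller [c * |f| - c^2] makes the estimate linear in
[|f|], so that it adds up along an orbit without the Cauchy-Schwarz inequality. *)
Lemma energy_step G g A M eta h P lam u e :
  mean_value G g ->
  (forall z, Cmod z <= A + 1 -> Cmod (g z) <= M) ->
  (forall z w, Cmod z <= A + 1 -> Cmod (w - z)%C < eta -> Cmod (g w - g z)%C < 1) ->
  0 < h -> h * (M + P) < eta -> 0 <= lam <= 1 -> Cmod e <= h * P ->
  let f := (RtoC (cutoff A u) * (RtoC h * g u - e))%C in
  let c := h * (P + 1) in
  lam * (c * Cmod f - c * c) <= h * (G u - G (u - RtoC lam * f)%C).
Proof.
intros HG HM Hu Hh Heta Hlam He f c.
pose proof (Cmod_ge_0 e) as He0.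
destruct (Rle_lt_dec (Cmod u) (A + 1)) as [Hin | Hout].
(* Outside the support of the cutoff the step is zero. *)
2:{ assert (f0 : f = RtoC 0).
    { unfold f; rewrite cutoff_outside by lra; ring. }
    rewrite f0, Cmod_0; replace (u - RtoC lam * RtoC 0)%C with u by
      (rewrite Cmult_0_r; unfold Cminus; rewrite Copp_0; now rewrite Cplus_0_r).
    nra. }
set (w := (RtoC h * g u - e)%C) in *.
pose proof (cutoff_bounds A u) as Hchi; set (chi := cutoff A u) in *.
assert (Hw : Cmod w <= h * (M + P)).
{ unfold w, Cminus; eapply Rle_trans; [apply Cmod_triangle |].
  rewrite Cmod_opp, Cmod_mult, Cmod_R, Rabs_pos_eq by lra.
  specialize (HM u Hin); nra. }
assert (Hf : Cmod f = chi * Cmod w).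
{ unfold f; rewrite Cmod_mult, Cmod_R, Rabs_pos_eq; lra. }
pose proof (Cmod_ge_0 w) as Hw0.
destruct (HG u (u - RtoC lam * f)%C) as [x [Hx E]].
replace (u - RtoC lam * f - u)%C with (RtoC (- lam) * f)%C in Hx, E
  by (rewrite RtoC_opp; ring).
rewrite Cmod_mult, Cmod_R, Rabs_Ropp, Rabs_pos_eq in Hx by lra.
rewrite dot_comm, dot_real_mult_l in E.
assert (Hfw : Cmod f <= Cmod w) by nra.
assert (Hg : Cmod (g x - g u)%C < 1).
{ apply Hu; [exact Hin |]; pose proof (Cmod_ge_0 f); nra. }
assert (H1 : dot f (g u) - Cmod f <= dot f (g x)).
{ pose proof (dot_Cmod_le f (g x - g u)%C) as h1; apply Rabs_le_between in h1.
  replace (dot f (g x - g u)%C) with (dot f (g x) - dot f (g u)) in h1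
    by (unfold dot; simpl; ring).
  pose proof (Cmod_ge_0 f); nra. }
assert (H2 : h * dot f (g u) = dot f w + dot f e).
{ unfold w, dot; simpl; ring. }
assert (H3 : - (h * P * Cmod f) <= dot f e).
{ pose proof (dot_Cmod_le f e) as h1; apply Rabs_le_between in h1.
  pose proof (Cmod_ge_0 f); nra. }
assert (H4 : Cmod f * Cmod f <= dot f w).
{ unfold f; rewrite dot_real_mult_l, <- Cmod_sqr; fold f; rewrite Hf.
  assert (0 <= Cmod w * Cmod w) by nra.
  replace (chi * Cmod w * (chi * Cmod w)) with (chi * chi * (Cmod w * Cmod w)) by ring.
  apply Rmult_le_compat_r; nra. }
replace (G u - G (u - RtoC lam * f)%C) with (lam * dot f (g x)) by lra.
assert (H5 : c * Cmod f - c * c <= h * dot f (g x)).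
{ assert (h * (dot f (g u) - Cmod f) <= h * dot f (g x)) by (apply Rmult_le_compat_l; lra).
  assert (0 <= (Cmod f - c) * (Cmod f - c)) by apply Rle_0_sqr.
  unfold c in *; nra. }
replace (h * (lam * dot f (g x))) with (lam * (h * dot f (g x))) by ring.
apply Rmult_le_compat_l; lra.
Qed.

Lemma energy_estimate G g A M eta h P D lam z j k :
  mean_value G g ->
  (forall z, Cmod z <= A + 1 -> Cmod (g z) <= M) ->
  (forall z w, Cmod z <= A + 1 -> Cmod (w - z)%C < eta -> Cmod (g w - g z)%C < 1) ->
  0 < h -> h * (M + P) < eta -> 0 <= lam <= 1 -> 0 <= P ->
  (forall i, Cmod (D (S i) - D i)%C <= h * P) ->
  let c := h * (P + 1) in
  lam * (c * Cmod (drift g A h D lam z (j + k) - drift g A h D lam z j)%C - INR k * (c * c))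
  <= h * (G (node g A h D lam z j) - G (node g A h D lam z (j + k))).
Proof.
intros HG HM Hu Hh Heta Hlam HP HD c.
induction k as [| k IH].
- rewrite Nat.add_0_r; replace (drift g A h D lam z j - drift g A h D lam z j)%C
    with (RtoC 0) by ring.
  rewrite Cmod_0; simpl; lra.
- rewrite Nat.add_succ_r.
  pose proof (energy_step G g A M eta h P lam (node g A h D lam z (j + k))
    (D (S (j + k)) - D (j + k)%nat)%C HG HM Hu Hh Heta Hlam (HD _)) as Hs.
  cbv zeta in Hs; fold c in Hs.
  set (f := (RtoC (cutoff A (node g A h D lam z (j + k))) *
    (RtoC h * g (node g A h D lam z (j + k)) - (D (S (j + k)) - D (j + k)%nat)))%C) in *.
  assert (E : drift g A h D lam z (S (j + k)) = (drift g A h D lam z (j + k) + f)%C)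
    by reflexivity.
  assert (E' : (node g A h D lam z (j + k) - RtoC lam * f)%C = node g A h D lam z (S (j + k))).
  { unfold node at 2; rewrite E; unfold node; ring. }
  rewrite E' in Hs; rewrite E, S_INR.
  assert (Ht : Cmod (drift g A h D lam z (j + k) + f - drift g A h D lam z j)%C <=
    Cmod (drift g A h D lam z (j + k) - drift g A h D lam z j)%C + Cmod f).
  { eapply Rle_trans; [| apply Cmod_triangle]; right; f_equal; ring. }
  assert (Hc : 0 < c) by (unfold c; nra).
  apply (Rmult_le_compat_l c) in Ht; [| lra].
  apply (Rmult_le_compat_l lam) in Ht; [| lra].
  nra.
Qed.

(** Along a periodic orbit the potential differences of the two arcs between [z] and
[node k] cancel; each arc is at least as long as the chord, whence the factor
[1 / 2]. *)
Lemma periodic_node_bound G g A M eta h P D lam z N k :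
  mean_value G g ->
  (forall z, Cmod z <= A + 1 -> Cmod (g z) <= M) ->
  (forall z w, Cmod z <= A + 1 -> Cmod (w - z)%C < eta -> Cmod (g w - g z)%C < 1) ->
  0 < h -> h * (M + P) < eta -> 0 <= lam <= 1 -> 0 <= P ->
  (forall i, Cmod (D (S i) - D i)%C <= h * P) ->
  drift g A h D lam z N = RtoC 0 -> (k <= N)%nat ->
  Cmod (node g A h D lam z k - z)%C <= INR N * h * (P + 1) / 2.
Proof.
intros HG HM Hu Hh Heta Hlam HP HD HN Hk.
set (c := h * (P + 1)).
assert (Hc : 0 < c) by (unfold c; nra).
replace (node g A h D lam z k - z)%C with (RtoC (- lam) * drift g A h D lam z k)%C
  by (unfold node; rewrite RtoC_opp; ring).
rewrite Cmod_mult, Cmod_R, Rabs_Ropp, Rabs_pos_eq by lra.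
replace (INR N * h * (P + 1) / 2) with (INR N * c / 2) by (unfold c; field).
pose proof (energy_estimate G g A M eta h P D lam z 0 k HG HM Hu Hh Heta Hlam HP HD) as H1.
pose proof (energy_estimate G g A M eta h P D lam z k (N - k) HG HM Hu Hh Heta Hlam HP HD) as H2.
cbv zeta in H1, H2; fold c in H1, H2.
replace (k + (N - k))%nat with N in H2 by lia; rewrite minus_INR in H2 by exact Hk.
rewrite Nat.add_0_l in H1.
assert (E : node g A h D lam z N = node g A h D lam z 0).
{ unfold node; rewrite HN; reflexivity. }
rewrite E, HN in H2; change (drift g A h D lam z 0) with (RtoC 0) in H1.
replace (drift g A h D lam z k - RtoC 0)%C with (drift g A h D lam z k) in H1
  by (unfold Cminus; rewrite Copp_0; now rewrite Cplus_0_r).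
replace (RtoC 0 - drift g A h D lam z k)%C with (- drift g A h D lam z k)%C in H2
  by (unfold Cminus; now rewrite Cplus_0_l).
rewrite Cmod_opp in H2.
set (d := Cmod (drift g A h D lam z k)) in *.
assert (H3 : lam * (c * (2 * d - INR N * c)) <= 0) by nra.
assert (Hd : 0 <= d) by apply Cmod_ge_0.
assert (HNc : 0 <= INR N * c) by (apply Rmult_le_pos; [apply pos_INR | lra]).
destruct (Rle_lt_dec (2 * d) (INR N * c)) as [h1 | h1]; [nra |].
assert (h2 : 0 < c * (2 * d - INR N * c)) by (apply Rmult_lt_0_compat; lra).
assert (h3 : lam <= 0) by nra.
replace lam with 0 by lra; lra.
Qed.

(** * Periodic orbits of the scheme *)

(** A zero of the drift is a periodic orbit, hence it stays near [z], where the cutoff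
is [1] and [g] keeps a positive component along [g z].  The increments of [D] add
up to zero over the period, so the component of the drift along [g z] is
positive. *)
Lemma drift_nonzero G g A M eta h P D lam z N :
  mean_value G g ->
  (forall w, Cmod w <= A + 1 -> Cmod (g w) <= M) ->
  (forall w w', Cmod w <= A + 1 -> Cmod (w' - w)%C < eta -> Cmod (g w' - g w)%C < 1) ->
  0 < h -> h * (M + P) < eta -> 0 <= lam <= 1 -> 0 <= P ->
  (forall i, Cmod (D (S i) - D i)%C <= h * P) ->
  (0 < N)%nat -> D N = D O -> Cmod z + INR N * h * (P + 1) / 2 <= A ->
  (forall w, Cmod (w - z)%C <= INR N * h * (P + 1) / 2 -> 0 < dot (g w) (g z)) ->
  drift g A h D lam z N <> RtoC 0.
Proof.
intros HG HM Hu Hh Heta Hlam HP HD HN0 HDN HA Hdot HN.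
assert (Hb : forall k, (k <= N)%nat ->
  Cmod (node g A h D lam z k - z)%C <= INR N * h * (P + 1) / 2).
{ intros k Hk; eapply periodic_node_bound; eassumption. }
assert (Hind : forall k, (k <= N)%nat ->
  0 <= dot (drift g A h D lam z k + (D k - D O))%C (g z) /\
  ((0 < k)%nat -> 0 < dot (drift g A h D lam z k + (D k - D O))%C (g z))).
{ induction k as [| k IH]; intros Hk.
  - split; [| lia]; right; simpl.
    replace (RtoC 0 + (D O - D O))%C with (RtoC 0) by ring.
    unfold dot, RtoC; simpl; ring.
  - destruct (IH ltac:(lia)) as [H0 _].
    specialize (Hb k ltac:(lia)); specialize (Hdot _ Hb).
    assert (E : (drift g A h D lam z (S k) + (D (S k) - D O))%C =
      (drift g A h D lam z k + (D k - D O) + RtoC h * g (node g A h D lam z k))%C).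
    { cbn [drift]; fold (node g A h D lam z k).
      rewrite cutoff_inside; [ring |].
      replace (node g A h D lam z k) with ((node g A h D lam z k - z) + z)%C by ring.
      eapply Rle_trans; [apply Cmod_triangle | lra]. }
    assert (0 < dot (drift g A h D lam z (S k) + (D (S k) - D O))%C (g z)); [| split; lra].
    rewrite E.
    set (a := (drift g A h D lam z k + (D k - D O))%C) in *.
    set (b := g (node g A h D lam z k)) in *.
    replace (dot (a + RtoC h * b)%C (g z)) with (dot a (g z) + h * dot b (g z))
      by (unfold dot; simpl; ring).
    assert (0 < h * dot b (g z)) by now apply Rmult_lt_0_compat. lra. }
destruct (Hind N (le_n N)) as [_ Hlt]; specialize (Hlt HN0).
rewrite HN, HDN in Hlt; replace (RtoC 0 + (D O - D O))%C with (RtoC 0) in Hlt by ring.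
unfold dot, RtoC in Hlt; simpl in Hlt; lra.
Qed.

(** If the drift at [lam = 1] had no zero in the disc, shrinking the circle to its
centre would give it winding number [0] along the circle; letting [lam] decrease
to [0], where the drift is a positive multiple of [g], would give winding number
[0] to [g]. *)
Lemma periodic_orbit_exists G g r A M eta h P D N :
  (forall w, continuous g w) ->
  mean_value G g ->
  (forall w, Cmod w <= A + 1 -> Cmod (g w) <= M) ->
  (forall w w', Cmod w <= A + 1 -> Cmod (w' - w)%C < eta -> Cmod (g w' - g w)%C < 1) ->
  0 < h -> h * (M + P) < eta -> 0 <= P ->
  (forall i, Cmod (D (S i) - D i)%C <= h * P) ->
  (0 < N)%nat -> D N = D O -> 0 <= r -> r + INR N * h * (P + 1) / 2 <= A ->
  (forall z w, Cmod z = r -> Cmod (w - z)%C <= INR N * h * (P + 1) / 2 -> 0 < dot (g w) (g z)) ->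
  ~ is_winding_number (fun t => g (RtoC r * cis t)%C) (RtoC 0) 0 ->
  exists z, Cmod z <= r /\ drift g A h D 1 z N = RtoC 0.
Proof.
intros Hg HG HM Hu Hh Heta HP HD HN HDN Hr HA Hdot HW.
apply NNPP; intros Hno; apply HW; clear HW.
assert (HB : 0 <= INR N * h * (P + 1) / 2).
{ pose proof (pos_INR N); assert (0 <= INR N * h) by (apply Rmult_le_pos; lra).
  assert (0 <= INR N * h * (P + 1)) by (apply Rmult_le_pos; lra). lra. }
assert (Hmod : forall s t, 0 <= s -> Cmod (RtoC s * cis t)%C = s).
{ intros s t Hs; rewrite Cmod_mult, Cmod_cis, Cmod_R, Rabs_pos_eq; lra. }
assert (Ccirc : forall (f : C -> R) x, continuous f x ->
  continuous (fun y : C => RtoC (f y) * cis (snd y))%C x).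
{ intros f x Hf; apply continuous_RtoC_mult; [exact Hf |].
  apply continuous_cis, continuous_im, continuous_id. }
(* At [lam = 1], grow the circle from its centre, where the curve is constant. *)
assert (W1 : is_winding_number (fun t => drift g A h D 1 (RtoC (1 * r) * cis t)%C N)
  (RtoC 0) 0).
{ apply (winding_number_homotopy
    (fun x => drift g A h D 1 (RtoC (fst x * r) * cis (snd x))%C N)).
  - intros s t _ _; apply continuous_drift; [exact Hg | apply continuous_const |].
    apply Ccirc, (continuous_mult (K := R_AbsRing)); [| apply continuous_const].
    apply continuous_re, continuous_id.
  - intros s t Hs _ E; apply Hno; exists (RtoC (s * r) * cis t)%C; split; [| exact E].
    rewrite Hmod by nra; nra.
  - intros s _; simpl; now rewrite cis_closed.
  - simpl.
    replace (fun t => drift g A h D 1 (RtoC (0 * r) * cis t)%C N)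
      with (fun _ : R => drift g A h D 1 (RtoC 0) N).
    + apply winding_number_const; intros E; apply Hno; exists (RtoC 0).
      rewrite Cmod_0; auto.
    + apply functional_extensionality; intros t; f_equal.
      rewrite Rmult_0_l; ring. }
rewrite Rmult_1_l in W1.
(* Let [lam] decrease from [1] to [0] along the circle. *)
assert (W2 : is_winding_number (fun t => drift g A h D (1 - 1) (RtoC r * cis t)%C N)
  (RtoC 0) 0).
{ apply (winding_number_homotopy
    (fun x => drift g A h D (1 - fst x) (RtoC r * cis (snd x))%C N)).
  - intros s t _ _; apply continuous_drift; [exact Hg | |].
    + apply (continuous_minus (V := R_NormedModule)); [apply continuous_const |].
      apply continuous_re, continuous_id.
    + apply Ccirc, continuous_const.
  - intros s t Hs _; simpl; apply (drift_nonzero G g A M eta h P); auto.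
    + lra.
    + rewrite Hmod; lra.
  - intros s _; simpl; now rewrite cis_closed.
  - simpl; rewrite Rminus_0_r; exact W1. }
assert (E : forall t, drift g A h D (1 - 1) (RtoC r * cis t)%C N =
  (RtoC (INR N * h) * g (RtoC r * cis t))%C).
{ intros t; rewrite Rminus_diag, drift_frozen by (rewrite Hmod; lra).
  rewrite HDN; ring. }
assert (Cg : forall t, continuous (fun t => g (RtoC r * cis t)%C) t).
{ intros t; apply (continuous_comp (fun t => RtoC r * cis t)%C g); [| apply Hg].
  apply continuous_RtoC_mult; [apply continuous_const |].
  apply continuous_cis, continuous_id. }
refine (winding_number_acute _ _ 0 _ _ _ _ _ W2).
- intros t _; apply continuous_drift; [exact Hg | apply continuous_const |].
  apply continuous_RtoC_mult; [apply continuous_const |].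
  apply continuous_cis, continuous_id.
- intros t _; apply Cg.
- now rewrite cis_closed.
- now rewrite cis_closed.
- intros t _; rewrite E, dot_real_mult_l; apply Rmult_lt_0_compat.
  + apply Rmult_lt_0_compat; [now apply lt_0_INR | exact Hh].
  + apply Hdot; [now apply Hmod |].
    replace (RtoC r * cis t - RtoC r * cis t)%C with (RtoC 0) by ring.
    now rewrite Cmod_0.
Qed.

(** A periodic orbit of the truncated scheme that starts in the disc of radius [r] is a
genuine Euler orbit: the estimate on one period keeps it where the cutoff is [1],
and periodicity extends this to all indices. *)
Lemma periodic_orbit_confined G g r A M eta h P D N z :
  mean_value G g ->
  (forall w, Cmod w <= A + 1 -> Cmod (g w) <= M) ->
  (forall w w', Cmod w <= A + 1 -> Cmod (w' - w)%C < eta -> Cmod (g w' - g w)%C < 1) ->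
  0 < h -> h * (M + P) < eta -> 0 <= P ->
  (forall i, Cmod (D (S i) - D i)%C <= h * P) ->
  (0 < N)%nat -> (forall i, D (S (i + N)) - D (i + N)%nat = D (S i) - D i)%C ->
  r + INR N * h * (P + 1) / 2 <= A ->
  Cmod z <= r -> drift g A h D 1 z N = RtoC 0 ->
  let u := node g A h D 1 z in
  (forall k, Cmod (u k) <= A) /\ (forall k, u (k + N)%nat = u k) /\
  (forall k, u (S k) = (u k - RtoC h * g (u k) + (D (S k) - D k))%C).
Proof.
intros HG HM Hu Hh Heta HP HD HN HDN HA Hz H0 u.
assert (Hrec : forall k, u (S k) =
  (u k - RtoC (cutoff A (u k)) * (RtoC h * g (u k) - (D (S k) - D k)))%C).
{ intros k; unfold u, node at 1; cbn [drift]; fold (node g A h D 1 z k).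
  unfold node at 3; ring. }
assert (Hper : forall k, u (k + N)%nat = u k).
{ induction k as [| k IH].
  - unfold u, node; simpl; rewrite H0; ring.
  - change (S k + N)%nat with (S (k + N)); rewrite !Hrec, IH, HDN; reflexivity. }
assert (Hin : forall k, (k <= N)%nat -> Cmod (u k) <= A).
{ intros k Hk; replace (u k) with ((u k - z) + z)%C by ring.
  eapply Rle_trans; [apply Cmod_triangle |].
  assert (Cmod (u k - z)%C <= INR N * h * (P + 1) / 2); [| lra].
  eapply periodic_node_bound; try eassumption; lra. }
assert (HAll : forall k, Cmod (u k) <= A).
{ intros k; induction k as [k IH] using (well_founded_induction lt_wf).
  destruct (Nat.le_gt_cases k N) as [h1 | h1]; [now apply Hin |].
  replace k with ((k - N) + N)%nat by lia; rewrite Hper; apply IH; lia. }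
split; [exact HAll | split; [exact Hper |]].
intros k; rewrite Hrec, cutoff_inside by apply HAll; ring.
Qed.

Definition euler_orbit (T : R) (g : C -> C) (Pi : R -> C) (N : nat) (u : nat -> C) : Prop :=
  forall k, u (S k) =
    (u k - RtoC (T / INR N) * g (u k) +
      (Pi (INR (S k) * (T / INR N))%R - Pi (INR k * (T / INR N))%R))%C.

Lemma periodic_euler_orbits T G g Pi P r :
  0 < T -> 0 <= P -> 0 < r ->
  (forall z, continuous g z) -> mean_value G g -> periodic T Pi ->
  (forall s t, Cmod (Pi t - Pi s)%C <= P * Rabs (t - s)) ->
  (forall z w, Cmod z = r -> Cmod (w - z)%C <= T * (P + 1) / 2 -> 0 < dot (g w) (g z)) ->
  ~ is_winding_number (fun t => g (RtoC r * cis t)%C) (RtoC 0) 0 ->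
  exists A N0, forall N, (N0 < N)%nat -> exists u, (forall k, Cmod (u k) <= A) /\
    (forall k, u (k + N)%nat = u k) /\ euler_orbit T g Pi N u.
Proof.
intros HT HP Hr Hg HG HPi HL Hdot HW.
set (A := r + T * (P + 1) / 2).
destruct (bounded_on_disc g (A + 1) Hg) as [M [HM0 HM]].
destruct (uniformly_continuous_on_compact (fun z => Cmod z <= A + 1) g (A + 1)
  (closed_disc _) (fun _ h => h) (fun z _ => Hg z) 1 Rlt_0_1) as [eta [Heta Hu]].
destruct (INR_unbounded (T * (M + P) / eta)) as [N0 HN0].
exists A, N0; intros N HN.
assert (HN' : (0 < N)%nat) by lia.
assert (PN : 0 < INR N) by now apply lt_0_INR.
assert (Hh : 0 < T / INR N) by now apply Rdiv_lt_0_compat.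
assert (ENh : INR N * (T / INR N) = T) by (field; lra).
set (h := T / INR N) in *.
assert (Hsmall : h * (M + P) < eta).
{ assert (HNN : T * (M + P) / eta < INR N).
  { apply Rlt_le_trans with (1 := HN0), le_INR; lia. }
  apply (Rmult_lt_compat_r (eta / INR N)) in HNN; [| now apply Rdiv_lt_0_compat].
  replace (T * (M + P) / eta * (eta / INR N)) with (h * (M + P)) in HNN
    by (unfold h; field; lra).
  replace (INR N * (eta / INR N)) with eta in HNN by (field; lra); exact HNN. }
set (D := fun k => Pi (INR k * h)).
assert (HD : forall k, Cmod (D (S k) - D k)%C <= h * P).
{ intros k; unfold D; eapply Rle_trans; [apply HL |]; rewrite S_INR.
  replace ((INR k + 1) * h - INR k * h) with h by ring.
  rewrite Rabs_pos_eq; lra. }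
assert (HDper : forall k, D (k + N)%nat = D k).
{ intros k; unfold D; rewrite plus_INR, Rmult_plus_distr_r, ENh; apply HPi. }
assert (HAB : r + INR N * h * (P + 1) / 2 <= A) by (rewrite ENh; unfold A; lra).
destruct (periodic_orbit_exists G g r A M eta h P D N) as [z [Hz Hz0]]; auto.
- exact (HDper O).
- lra.
- intros z w Hz Hw; apply Hdot; [exact Hz |]; now rewrite ENh in Hw.
- exists (node g A h D 1 z).
  apply (periodic_orbit_confined G g r A M eta h P D N z); auto.
  intros i; change (S (i + N)) with (S i + N)%nat; now rewrite !HDper.
Qed.

(** * Passage to the limit *)

Lemma is_derive_C (f : R -> C) (x : R) (l : C) :
  (forall eps, 0 < eps -> exists delta, 0 < delta /\
    forall y, Rabs (y - x) < delta ->
      Cmod (f y - f x - RtoC (y - x) * l)%C <= eps * Rabs (y - x)) ->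
  is_derive (V := C_R_NormedModule) f x l.
Proof.
intros H; split; [apply is_linear_scal_l |].
intros x' Hx'.
assert (E : x = x').
{ exact (is_filter_lim_locally_unique (K := R_AbsRing) (V := R_NormedModule) x x' Hx'). }
subst x'; intros eps.
destruct (H eps (cond_pos eps)) as [d [Hd Hy]].
exists (mkposreal d Hd); intros y Hball.
specialize (Hy y Hball).
rewrite <- (scal_R_Cmult (y - x) l), Cmod_norm in Hy; exact Hy.
Qed.

Lemma euler_increment (u : nat -> C) g h D A M P :
  0 < h -> (forall k, Cmod (u k) <= A) -> (forall z, Cmod z <= A -> Cmod (g z) <= M) ->
  (forall k, Cmod (D (S k) - D k)%C <= h * P) ->
  (forall k, u (S k) = (u k - RtoC h * g (u k) + (D (S k) - D k))%C) ->
  forall j k, Cmod (u (j + k)%nat - u j)%C <= INR k * h * (M + P).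
Proof.
intros Hh HA HM HD Hu j k; induction k as [| k IH].
- rewrite Nat.add_0_r; replace (u j - u j)%C with (RtoC 0) by ring.
  rewrite Cmod_0; simpl; lra.
- rewrite Nat.add_succ_r, Hu, S_INR.
  set (v := u (j + k)%nat) in *; set (e := (D (S (j + k)) - D (j + k)%nat)%C).
  assert (He : Cmod e <= h * P) by apply HD.
  assert (Hg : Cmod (RtoC h * g v)%C <= h * M).
  { rewrite Cmod_mult, Cmod_R, Rabs_pos_eq by lra.
    apply Rmult_le_compat_l; [lra | apply HM, HA]. }
  replace (v - RtoC h * g v + e - u j)%C with ((v - u j) + (- (RtoC h * g v) + e))%C by ring.
  eapply Rle_trans; [apply Cmod_triangle |].
  pose proof (Cmod_triangle (- (RtoC h * g v))%C e) as Ht; rewrite Cmod_opp in Ht.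
  nra.
Qed.

Lemma euler_linearization (u : nat -> C) g h D e c :
  0 < h -> (forall k, u (S k) = (u k - RtoC h * g (u k) + (D (S k) - D k))%C) ->
  forall j k, (forall i, (i < k)%nat -> Cmod (g (u (j + i)%nat) - c)%C <= e) ->
  Cmod (u (j + k)%nat - u j - (D (j + k)%nat - D j) + RtoC (INR k * h) * c)%C
    <= INR k * h * e.
Proof.
intros Hh Hu j k; induction k as [| k IH]; intros Hi.
- rewrite Nat.add_0_r; simpl; rewrite Rmult_0_l.
  replace (u j - u j - (D j - D j) + RtoC 0 * c)%C with (RtoC 0) by ring.
  rewrite Cmod_0; lra.
- rewrite Nat.add_succ_r, Hu, S_INR.
  specialize (IH (fun i hi => Hi i (Nat.lt_lt_succ_r _ _ hi))).
  assert (Hk := Hi k (Nat.lt_succ_diag_r k)).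
  set (v := u (j + k)%nat) in *.
  replace (v - RtoC h * g v + (D (S (j + k)) - D (j + k)%nat) - u j - (D (S (j + k)) - D j)
     + RtoC ((INR k + 1) * h) * c)%C
    with ((v - u j - (D (j + k)%nat - D j) + RtoC (INR k * h) * c) + - (RtoC h * (g v - c)))%C
    by (rewrite Rmult_plus_distr_r, Rmult_1_l, RtoC_plus; ring).
  eapply Rle_trans; [apply Cmod_triangle |].
  rewrite Cmod_opp, Cmod_mult, Cmod_R, (Rabs_pos_eq h) by lra.
  nra.
Qed.

(** The reference value of [g] is taken at [u j] both for [j <= m] and for [m <= j],
which gives a two-sided derivative in the limit. *)
Lemma euler_linearization_two_sided (u : nat -> C) g h D A M P delta e :
  0 < h -> (forall k, Cmod (u k) <= A) -> (forall z, Cmod z <= A -> Cmod (g z) <= M) ->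
  (forall k, Cmod (D (S k) - D k)%C <= h * P) ->
  (forall k, u (S k) = (u k - RtoC h * g (u k) + (D (S k) - D k))%C) ->
  (forall z w, Cmod z <= A -> Cmod (w - z)%C < delta -> Cmod (g w - g z)%C < e) ->
  0 <= M + P ->
  forall j m, Rabs (INR m * h - INR j * h) * (M + P) < delta ->
  Cmod (u m - u j - (D m - D j) + RtoC (INR m * h - INR j * h) * g (u j))%C
    <= e * Rabs (INR m * h - INR j * h).
Proof.
intros Hh HA HM HD Hu Hg HMP j m Hjm.
assert (Hinc := euler_increment u g h D A M P Hh HA HM HD Hu).
destruct (Nat.le_ge_cases j m) as [H | H].
- destruct (Nat.le_exists_sub j m H) as [k [Hk _]]; rewrite Nat.add_comm in Hk; subst m.
  rewrite plus_INR in *.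
  replace ((INR j + INR k) * h - INR j * h) with (INR k * h) in * by ring.
  assert (Hkh : 0 <= INR k * h) by (apply Rmult_le_pos; [apply pos_INR | lra]).
  rewrite Rabs_pos_eq in * by exact Hkh.
  rewrite (Rmult_comm e); apply (euler_linearization u g); auto.
  intros i Hi; apply Rlt_le, Hg; [apply HA |].
  apply Rle_lt_trans with (2 := Hjm); eapply Rle_trans; [apply Hinc |].
  apply Rmult_le_compat_r; [lra |]; apply Rmult_le_compat_r; [lra |].
  apply le_INR; lia.
- destruct (Nat.le_exists_sub m j H) as [k [Hk _]]; rewrite Nat.add_comm in Hk; subst j.
  rewrite plus_INR in *.
  replace (INR m * h - (INR m + INR k) * h) with (- (INR k * h)) in * by ring.
  assert (Hkh : 0 <= INR k * h) by (apply Rmult_le_pos; [apply pos_INR | lra]).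
  rewrite Rabs_Ropp, Rabs_pos_eq in * by exact Hkh.
  rewrite (Rmult_comm e).
  replace (u m - u (m + k)%nat - (D m - D (m + k)%nat) + RtoC (- (INR k * h)) * g (u (m + k)%nat))%C
    with (- (u (m + k)%nat - u m - (D (m + k)%nat - D m) + RtoC (INR k * h) * g (u (m + k)%nat)))%C
    by (rewrite RtoC_opp; ring).
  rewrite Cmod_opp; apply (euler_linearization u g); auto.
  intros i Hi; apply Rlt_le, Hg; [apply HA |].
  apply Rle_lt_trans with (2 := Hjm).
  replace (u (m + i)%nat - u (m + k)%nat)%C with (- (u (m + i + (k - i))%nat - u (m + i)%nat))%C
    by (replace (m + i + (k - i))%nat with (m + k)%nat by lia; ring).
  rewrite Cmod_opp; eapply Rle_trans; [apply Hinc |].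
  apply Rmult_le_compat_r; [lra |]; apply Rmult_le_compat_r; [lra |].
  apply le_INR; lia.
Qed.

(** The shift by [N * N] steps is a time [N * T], a whole number of periods; it makes
the index nonnegative for a given [t] as soon as [N] is large, so that sequences
indexed by [nat] serve all real times. *)
Definition grid_index (T : R) (N : nat) (t : R) : nat :=
  Z.to_nat (up (t * INR N / T) + Z.of_nat N * Z.of_nat N).

Definition grid_time (T : R) (N : nat) (t : R) : R :=
  INR (grid_index T N t) * (T / INR N) - INR N * T.

Lemma grid_index_spec T N t : 0 < T -> (0 < N)%nat -> Rabs t <= INR N * T ->
  INR (grid_index T N t) = IZR (up (t * INR N / T)) + INR N * INR N.
Proof.
intros HT HN Ht; apply lt_0_INR in HN; apply Rabs_le_between in Ht.
unfold grid_index; rewrite INR_IZR_INZ, Z2Nat.id.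
- rewrite plus_IZR, mult_IZR, <- INR_IZR_INZ; reflexivity.
- apply le_IZR; rewrite plus_IZR, mult_IZR, <- INR_IZR_INZ.
  destruct (archimed (t * INR N / T)) as [h _].
  assert (- (INR N * INR N) <= t * INR N / T); [| lra].
  apply (Rmult_le_reg_r T); [exact HT |].
  replace (t * INR N / T * T) with (t * INR N) by (field; lra).
  nra.
Qed.

Lemma grid_time_near T N t : 0 < T -> (0 < N)%nat -> Rabs t <= INR N * T ->
  Rabs (grid_time T N t - t) <= T / INR N.
Proof.
intros HT HN Ht; unfold grid_time; rewrite grid_index_spec by assumption.
apply lt_0_INR in HN.
destruct (archimed (t * INR N / T)) as [h1 h2].
set (y := IZR (up (t * INR N / T))) in *.
assert (Hh : 0 < T / INR N) by now apply Rdiv_lt_0_compat.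
replace ((y + INR N * INR N) * (T / INR N) - INR N * T - t)
  with ((y - t * INR N / T) * (T / INR N)) by (field; lra).
rewrite Rabs_mult, !Rabs_pos_eq by lra.
rewrite <- (Rmult_1_l (T / INR N)) at 2; apply Rmult_le_compat_r; lra.
Qed.

Lemma grid_index_shift T N t : 0 < T -> (0 < N)%nat ->
  Rabs t <= INR N * T -> Rabs (t + T) <= INR N * T ->
  grid_index T N (t + T) = (grid_index T N t + N)%nat.
Proof.
intros HT HN H1 H2; apply INR_eq; rewrite plus_INR, !grid_index_spec by assumption.
apply lt_0_INR in HN.
replace ((t + T) * INR N / T) with (t * INR N / T + INR N) by (field; lra).
rewrite <- (tech_up (t * INR N / T + INR N) (up (t * INR N / T) + Z.of_nat N)).
- rewrite plus_IZR, <- INR_IZR_INZ; ring.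
- rewrite plus_IZR, <- INR_IZR_INZ; destruct (archimed (t * INR N / T)); lra.
- rewrite plus_IZR, <- INR_IZR_INZ; destruct (archimed (t * INR N / T)); lra.
Qed.

Lemma periodic_nat T f t n : periodic T f -> f (t + INR n * T) = f t.
Proof.
intros Hf; induction n as [| n IH].
- simpl; now rewrite Rmult_0_l, Rplus_0_r.
- rewrite S_INR; replace (t + (INR n + 1) * T) with (t + INR n * T + T) by ring.
  now rewrite Hf.
Qed.

(** The orbits converge along the ultrafilter at every time at once.  For [t] near
[s], [euler_linearization_two_sided] bounds
[u t - u s - (Pi t - Pi s) + (t - s) * g (u s)] by [eps * |t - s|] with a
tolerance on [|t - s|] independent of [N]; this inequality survives the pointwise
limit and says that [u - Pi] has derivative [- g (u s)] at [s]. *)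
Lemma euler_limit T g Pi dPi P A N0 :
  0 < T -> 0 <= P -> (forall z, continuous g z) -> periodic T Pi ->
  (forall s t, Cmod (Pi t - Pi s)%C <= P * Rabs (t - s)) ->
  (forall t, is_derive (V := C_R_NormedModule) Pi t (dPi t)) ->
  (forall N, (N0 < N)%nat -> exists u, (forall k, Cmod (u k) <= A) /\
    (forall k, u (k + N)%nat = u k) /\ euler_orbit T g Pi N u) ->
  exists u, periodic T u /\
    forall t, is_derive (V := C_R_NormedModule) u t (dPi t - g (u t))%C.
Proof.
intros HT HP Hg HPi HL Hd Horb.
destruct (bounded_on_disc g A Hg) as [M [HM0 HM]].
pose (N := fun n => S (N0 + n)).
assert (HN : forall n, (N0 < N n)%nat) by (unfold N; intros; lia).
pose (u := fun n => proj1_sig (constructive_indefinite_description _ (Horb (N n) (HN n)))).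
assert (Hu : forall n, (forall k, Cmod (u n k) <= A) /\
  (forall k, u n (k + N n)%nat = u n k) /\ euler_orbit T g Pi (N n) (u n)).
{ intros n; exact (proj2_sig (constructive_indefinite_description _ (Horb (N n) (HN n)))). }
clearbody u.
assert (HN0 : forall n, (0 < N n)%nat) by (unfold N; intros; lia).
destruct ultra_exists as [U HU]; pose proof HU as [PU [_ HE]].
assert (Hbig : forall B, U (fun n => B < INR (N n))).
{ intros B; apply HE; destruct (INR_unbounded B) as [m Hm]; exists m; intros n Hn.
  apply Rlt_le_trans with (1 := Hm), le_INR; unfold N; lia. }
clearbody N.
assert (PN : forall n, 0 < INR (N n)) by (intros n; apply lt_0_INR, HN0).
assert (Hin : forall t, U (fun n => Rabs t <= INR (N n) * T)).
{ intros t; generalize (Hbig (Rabs t / T)); apply filter_imp; intros n Hn.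
  apply (Rmult_lt_compat_r T) in Hn; [| exact HT].
  replace (Rabs t / T * T) with (Rabs t) in Hn by (field; lra); lra. }
pose (x := fun t n => u n (grid_index T (N n) t)).
pose (tau := fun t n => grid_time T (N n) t).
assert (Hlim : forall t, exists l : C, filterlim (x t) U (locally l)).
{ intros t; apply (ultra_limit U (x t) A HU); intros n; apply Hu. }
pose (l := fun t => proj1_sig (constructive_indefinite_description _ (Hlim t))).
assert (Hl : forall t, filterlim (x t) U (locally (l t))).
{ intros t; exact (proj2_sig (constructive_indefinite_description _ (Hlim t))). }
clearbody l.
assert (Htau : forall t, filterlim (tau t) U (locally t)).
{ intros t; apply (proj2 (filterlim_locally _ _)); intros eps.
  generalize (filter_and _ _ (Hin t) (Hbig (T / eps))); apply filter_imp.
  intros n [h1 h2]; change (Rabs (tau t n - t) < eps).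
  eapply Rle_lt_trans; [exact (grid_time_near T (N n) t HT (HN0 n) h1) |].
  pose proof (cond_pos eps).
  apply (Rmult_lt_reg_r (INR (N n))); [apply PN |].
  apply (Rmult_lt_compat_r eps) in h2; [| lra].
  replace (T / eps * eps) with T in h2 by (field; lra).
  replace (T / INR (N n) * INR (N n)) with T by (field; specialize (PN n); lra); lra. }
assert (HPiC : forall t, continuous Pi t).
{ intros t; apply (filterlim_Cmod (locally t) Pi (Pi t)); intros eps Heps.
  assert (He : 0 < eps / (P + 1)) by (apply Rdiv_lt_0_compat; lra).
  exists (mkposreal _ He); intros y Hy; change (Rabs (y - t) < eps / (P + 1)) in Hy.
  eapply Rle_lt_trans; [apply HL |].
  apply (Rmult_lt_compat_l (P + 1)) in Hy; [| lra].
  replace ((P + 1) * (eps / (P + 1))) with eps in Hy by (field; lra).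
  pose proof (Rabs_pos (y - t)); nra. }
assert (Hlin : forall s eps, 0 < eps -> exists delta, 0 < delta /\ forall t,
  Rabs (t - s) < delta ->
  Cmod (l t - l s - (Pi t - Pi s) + RtoC (t - s) * g (l s))%C <= eps * Rabs (t - s)).
{ intros s eps Heps.
  destruct (uniformly_continuous_on_compact (fun z => Cmod z <= A) g A (closed_disc A)
    (fun _ h => h) (fun z _ => Hg z) eps Heps) as [d [Hd0 Hd1]].
  exists (d / (M + P)); split; [apply Rdiv_lt_0_compat; lra |].
  intros t Ht.
  assert (Ht' : Rabs (t - s) * (M + P) < d).
  { apply (Rmult_lt_compat_r (M + P)) in Ht; [| lra].
    replace (d / (M + P) * (M + P)) with d in Ht by (field; lra); exact Ht. }
  assert (HD : filterlim (fun n => tau t n - tau s n) U (locally (t - s))).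
  { exact (filterlim_comp_2 (tau t) (fun n => - tau s n) Rplus (Htau t)
      (filterlim_comp _ _ _ (tau s) Ropp _ _ _ (Htau s) (filterlim_opp (V := R_NormedModule) s))
      (filterlim_plus (V := R_NormedModule) t (- s))). }
  assert (HDabs : filterlim (fun n => Rabs (tau t n - tau s n)) U (locally (Rabs (t - s)))).
  { exact (filterlim_comp _ _ _ _ Rabs _ _ _ HD (continuous_Rabs (t - s))). }
  assert (HDM : forall c, filterlim (fun n => c * Rabs (tau t n - tau s n)) U
    (locally (c * Rabs (t - s)))).
  { intros c; refine (filterlim_comp _ _ _ _ (fun y => c * y) _ _ _ HDabs _).
    exact (filterlim_scal_r (V := R_NormedModule) c (Rabs (t - s))). }
  apply (filterlim_bound U
    (fun n => x t n - x s n - (Pi (tau t n) - Pi (tau s n))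
      + RtoC (tau t n - tau s n) * g (x s n))%C
    (fun n => eps * Rabs (tau t n - tau s n))).
  - apply (filterlim_Cplus U); [apply (filterlim_Cminus U);
      [apply (filterlim_Cminus U); apply Hl |] |].
    + apply (filterlim_Cminus U).
      * exact (filterlim_comp _ _ _ (tau t) Pi _ _ _ (Htau t) (HPiC t)).
      * exact (filterlim_comp _ _ _ (tau s) Pi _ _ _ (Htau s) (HPiC s)).
    + apply (filterlim_RtoC_mult U); [exact HD |].
      exact (filterlim_comp _ _ _ (x s) g _ _ _ (Hl s) (Hg (l s))).
  - apply HDM.
  - assert (Hsmall : U (fun n => (M + P) * Rabs (tau t n - tau s n) < d)).
    { rewrite Rmult_comm in Ht'; exact (HDM (M + P) _ (open_lt d _ Ht')). }
    revert Hsmall; apply filter_imp; intros n Hn.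
    destruct (Hu n) as [HA [_ Ho]].
    assert (Hh : 0 < T / INR (N n)) by (apply Rdiv_lt_0_compat; auto).
    assert (Et : tau t n - tau s n = INR (grid_index T (N n) t) * (T / INR (N n))
      - INR (grid_index T (N n) s) * (T / INR (N n))).
    { unfold tau, grid_time; ring. }
    (* Grid times differ from index times by [N] periods. *)
    assert (EPi : forall r, Pi (tau r n) = Pi (INR (grid_index T (N n) r) * (T / INR (N n)))).
    { intros r; rewrite <- (periodic_nat T Pi (tau r n) (N n) HPi); f_equal.
      unfold tau, grid_time; ring. }
    rewrite !EPi, Et in *.
    refine (euler_linearization_two_sided (u n) g (T / INR (N n))
      (fun k => Pi (INR k * (T / INR (N n)))) A M P d eps Hh HA HM _ Ho Hd1 _ _ _ _).
    + intros k; eapply Rle_trans; [apply HL |].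
      rewrite S_INR; replace ((INR k + 1) * (T / INR (N n)) - INR k * (T / INR (N n)))
        with (T / INR (N n)) by ring.
      rewrite Rabs_pos_eq; lra.
    + lra.
    + rewrite Rmult_comm; exact Hn. }
exists l; split.
- intros t.
  apply (filterlim_locally_unique (V := C_R_NormedModule) (F := U) (x (t + T))).
  + apply Hl.
  + apply (filterlim_ext_loc (x t)); [| apply Hl].
    generalize (filter_and _ _ (Hin t) (Hin (t + T))); apply filter_imp.
    intros n [h1 h2]; unfold x; rewrite grid_index_shift by auto.
    symmetry; apply Hu.
- intros s.
  assert (H1 : is_derive (V := C_R_NormedModule) (fun t => l t - Pi t)%C s (- g (l s))%C).
  { apply is_derive_C; intros eps Heps.
    destruct (Hlin s eps Heps) as [d [Hd0 Hd1]]; exists d; split; [exact Hd0 |].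
    intros t Ht; specialize (Hd1 t Ht).
    replace (l t - Pi t - (l s - Pi s) - RtoC (t - s) * - g (l s))%C
      with (l t - l s - (Pi t - Pi s) + RtoC (t - s) * g (l s))%C by ring.
    exact Hd1. }
  pose proof (is_derive_plus (V := C_R_NormedModule) _ _ s _ _ (Hd s) H1) as H2.
  apply (is_derive_ext (V := C_R_NormedModule)) with (g := l) in H2; [exact H2 |].
  intros t; change (Pi t + (l t - Pi t) = l t)%C; ring.
Qed.

(** * Gradients *)

Lemma is_derive_affine (a w : C) s :
  is_derive (V := C_R_NormedModule) (fun r => a + RtoC r * w)%C s w.
Proof.
apply is_derive_C; intros eps Heps; exists 1; split; [lra |]; intros y _.
replace (a + RtoC y * w - (a + RtoC s * w) - RtoC (y - s) * w)%C with (RtoC 0)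
  by (rewrite RtoC_minus; ring).
rewrite Cmod_0; apply Rmult_le_pos; [lra | apply Rabs_pos].
Qed.

(** The differential is linear over the reals, so it is determined by its values on
the two axes, which are the partial derivatives. *)
Lemma gradient_along_line G a w s : continuously_differentiable G ->
  is_derive (fun r => G (a + RtoC r * w)%C) s (dot (gradient G (a + RtoC s * w)%C) w).
Proof.
intros [HG _].
assert (Hline : forall z w l, filterdiff (U := C_R_NormedModule) (V := R_NormedModule) G
    (locally z) l -> forall a s, (a + RtoC s * w)%C = z ->
    is_derive (fun r => G (a + RtoC r * w)%C) s (l w)).
{ intros z v l Hl b r E.
  assert (Hl' := Hl); destruct Hl' as [Hlin _].
  rewrite <- E in Hl.
  pose proof (filterdiff_comp' (V := C_R_NormedModule) _ G r _ l (is_derive_affine b v r) Hl) as H.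
  refine (filterdiff_ext_lin _ _ _ H _).
  intros y; exact (linear_scal l Hlin y v). }
set (z := (a + RtoC s * w)%C); destruct (HG z) as [l Hl].
assert (Hlin : is_linear (U := C_R_NormedModule) (V := R_NormedModule) l) by apply Hl.
(* [l (1, 0)] and [l (0, 1)] are derivatives along the coordinate lines. *)
assert (E1 : Derive (fun x => G (x, Im z)) (Re z) = l (1, 0)).
{ apply is_derive_unique.
  apply (is_derive_ext (fun r => G ((0, Im z) + RtoC r * (1, 0))%C)).
  - intros t; f_equal; unfold RtoC, Cplus, Cmult; simpl; f_equal; ring.
  - apply (Hline z); [exact Hl |].
    rewrite (surjective_pairing z); unfold RtoC, Cplus, Cmult, Re, Im; simpl; f_equal; ring. }
assert (E2 : Derive (fun y => G (Re z, y)) (Im z) = l (0, 1)).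
{ apply is_derive_unique.
  apply (is_derive_ext (fun r => G ((Re z, 0) + RtoC r * (0, 1))%C)).
  - intros t; f_equal; unfold RtoC, Cplus, Cmult; simpl; f_equal; ring.
  - apply (Hline z); [exact Hl |].
    rewrite (surjective_pairing z); unfold RtoC, Cplus, Cmult, Re, Im; simpl; f_equal; ring. }
replace (dot (gradient G z) w) with (l w); [apply (Hline z); auto |].
unfold gradient; rewrite E1, E2; unfold dot; cbn [fst snd].
transitivity (l (plus (G := C_R_NormedModule) (scal (V := C_R_NormedModule) (fst w) (1, 0))
  (scal (V := C_R_NormedModule) (snd w) (0, 1)))).
- f_equal; rewrite (surjective_pairing w) at 1.
  unfold plus, scal; simpl; unfold prod_plus, prod_scal, scal, plus, mult; simpl.
  unfold mult; simpl; f_equal; ring.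
- rewrite (linear_plus l Hlin), !(linear_scal l Hlin).
  unfold plus, scal; simpl; unfold mult; simpl; ring.
Qed.

(** The mean value theorem on the segment from [a] to [b]; subtracting the constant
[pb] from the gradient subtracts a linear form from the potential. *)
Lemma gradient_mean_value G pb : continuously_differentiable G ->
  mean_value (fun z => G z - dot pb z) (fun z => gradient G z - pb)%C.
Proof.
intros HG a b.
set (w := (b - a)%C).
assert (Hd := fun s => gradient_along_line G a w s HG).
destruct (MVT_gen (fun r => G (a + RtoC r * w)%C) 0 1
  (fun s => dot (gradient G (a + RtoC s * w)%C) w)) as [c [Hc E]].
- intros s _; apply Hd.
- intros s _; apply continuity_pt_filterlim.
  apply (ex_derive_continuous (K := R_AbsRing) (V := R_NormedModule)).
  eexists; apply Hd.
- rewrite Rmin_left, Rmax_right in Hc by lra.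
  exists (a + RtoC c * w)%C; split.
  + replace (a + RtoC c * w - a)%C with (RtoC c * w)%C by ring.
    rewrite Cmod_mult, Cmod_R, Rabs_pos_eq by lra; fold w.
    pose proof (Cmod_ge_0 w); nra.
  + replace (a + RtoC 1 * w)%C with b in E by (unfold w; ring).
    replace (a + RtoC 0 * w)%C with a in E by ring.
    replace (dot (gradient G (a + RtoC c * w) - pb)%C w)
      with (dot (gradient G (a + RtoC c * w)%C) w - dot pb w) by (unfold dot; simpl; ring).
    replace (dot pb w) with (dot pb b - dot pb a) by (unfold w, dot; simpl; ring).
    fold w; lra.
Qed.

(** * Periodic functions and their primitives *)

Lemma periodic_representative T (f : R -> C) t : 0 < T -> periodic T f ->
  exists s, 0 <= s <= T /\ f s = f t.
Proof.
intros HT Hf.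
destruct (INR_unbounded (Rabs t / T)) as [n Hn].
assert (Ht : 0 <= t + INR n * T).
{ apply (Rmult_lt_compat_r T) in Hn; [| exact HT].
  replace (Rabs t / T * T) with (Rabs t) in Hn by (field; lra).
  pose proof (Rabs_le_between t (Rabs t)) as [h _]; specialize (h (Rle_refl _)); lra. }
destruct (nfloor_ex ((t + INR n * T) / T)) as [m [h1 h2]].
{ apply Rmult_le_pos; [exact Ht | now apply Rlt_le, Rinv_0_lt_compat]. }
exists (t + INR n * T - INR m * T); split.
- apply (Rmult_le_compat_r T) in h1; [| lra]; apply (Rmult_lt_compat_r T) in h2; [| lra].
  replace ((t + INR n * T) / T * T) with (t + INR n * T) in h1, h2 by (field; lra). lra.
- rewrite <- (periodic_nat T f t n Hf), <- (periodic_nat T f (t + INR n * T - INR m * T) m Hf).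
  f_equal; ring.
Qed.

Lemma periodic_bounded T (f : R -> C) : 0 < T -> periodic T f ->
  (forall t, continuous f t) -> exists P, 0 < P /\ forall t, Cmod (f t) <= P.
Proof.
intros HT Hf Hc.
destruct (bounded_on_disc (fun z => f (fst z)) T) as [P [HP0 HP]].
{ intros z; apply (continuous_comp (fun z : C => fst z) f); [| apply Hc].
  apply continuous_re, continuous_id. }
exists P; split; [exact HP0 |]; intros t.
destruct (periodic_representative T f t HT Hf) as [s [Hs <-]].
apply (HP (RtoC s)); rewrite Cmod_R, Rabs_pos_eq; lra.
Qed.

(** The integral over one period vanishes, hence the primitive is itself periodic; a
bound of [f] is a Lipschitz constant of the primitive. *)
Lemma periodic_primitive T (f : R -> C) P : 0 < T -> periodic T f ->
  (forall t, continuous f t) -> (forall t, Cmod (f t) <= P) ->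
  RInt (V := C_R_CompleteNormedModule) f 0 T = RtoC 0 ->
  exists F : R -> C, periodic T F /\
    (forall t, is_derive (V := C_R_NormedModule) F t (f t)) /\
    (forall s t, Cmod (F t - F s)%C <= P * Rabs (t - s)).
Proof.
intros HT Hf Hc HP H0.
assert (Hex : forall a b, ex_RInt (V := C_R_CompleteNormedModule) f a b).
{ intros a b; apply (ex_RInt_continuous (V := C_R_CompleteNormedModule)); intros; apply Hc. }
set (F := fun t => RInt (V := C_R_CompleteNormedModule) f 0 t).
assert (HF : forall s t, (F s + RInt (V := C_R_CompleteNormedModule) f s t)%C = F t).
{ intros s t; exact (RInt_Chasles (V := C_R_CompleteNormedModule) f 0 s t (Hex _ _) (Hex _ _)). }
exists F; split; [| split].
- intros t; rewrite <- (HF T); unfold F at 1; rewrite H0, Cplus_0_l.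
  replace T with (1 * 0 + T) at 1 by ring; replace (t + T) with (1 * t + T) by ring.
  rewrite <- (RInt_comp_lin (V := C_R_CompleteNormedModule)) by apply Hex.
  unfold F; apply (RInt_ext (V := C_R_CompleteNormedModule)); intros x _.
  rewrite (scal_one (V := C_R_NormedModule)); rewrite Rmult_1_l; apply Hf.
- intros t; apply (is_derive_RInt (V := C_R_NormedModule) f F 0 t); [| apply Hc].
  apply filter_forall; intros x; exact (RInt_correct (V := C_R_CompleteNormedModule) f 0 x (Hex _ _)).
- assert (Hle : forall s t, s <= t -> Cmod (F t - F s)%C <= P * (t - s)).
  { intros s t Hst; rewrite <- (HF s t).
    assert (E : forall a b : C, (a + b - a)%C = b) by (intros a b; ring).
    rewrite E, Cmod_norm, Rmult_comm.
    apply (norm_RInt_le_const (V := C_R_NormedModule) f s t); [exact Hst | |].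
    - intros x _; rewrite <- Cmod_norm; apply HP.
    - exact (RInt_correct (V := C_R_CompleteNormedModule) f s t (Hex _ _)). }
  intros s t; destruct (Rle_lt_dec s t) as [h | h].
  + rewrite Rabs_pos_eq by lra; now apply Hle.
  + rewrite Rabs_left by lra.
    replace (F t - F s)%C with (- (F s - F t))%C by ring; rewrite Cmod_opp.
    replace (- (t - s)) with (s - t) by ring; apply Hle; lra.
Qed.

Lemma RInt_minus_average T p : 0 < T -> (forall t, continuous p t) ->
  RInt (V := C_R_CompleteNormedModule) (fun t => p t - average T p)%C 0 T = RtoC 0.
Proof.
intros HT Hc.
set (pb := average T p).
assert (Hex : ex_RInt (V := C_R_CompleteNormedModule) p 0 T).
{ apply (ex_RInt_continuous (V := C_R_CompleteNormedModule)); intros; apply Hc. }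
transitivity (minus (G := C_R_NormedModule) (RInt (V := C_R_CompleteNormedModule) p 0 T)
  (RInt (V := C_R_CompleteNormedModule) (fun _ => pb) 0 T)).
{ apply (RInt_minus (V := C_R_CompleteNormedModule)); [exact Hex | apply ex_RInt_const]. }
rewrite RInt_const, scal_R_Cmult.
change (RInt (V := C_R_CompleteNormedModule) p 0 T - RtoC (T - 0) * pb = RtoC 0)%C.
unfold pb, average; rewrite Rminus_0_r, RtoC_inv by lra; field.
intros h; apply RtoC_inj in h; lra.
Qed.

(** * The field at infinity *)

Lemma radial_limit_direction g q : 
  uniform_radial_limit (fun r v => direction (g (RtoC r * v)%C)) q ->
  forall eps, 0 < eps -> exists r0, forall z, r0 < Cmod z -> z <> RtoC 0 ->
  Cmod (direction (g z) - q (direction z))%C < eps.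
Proof.
intros Hq eps Heps; destruct (Hq eps Heps) as [r0 Hr]; exists r0; intros z Hz Hz0.
specialize (Hr (Cmod z) (direction z) Hz (Cmod_direction z Hz0)).
now rewrite <- direction_polar in Hr.
Qed.

(** On the unit circle [q] is a uniform limit of the maps
[v |-> direction (g (r * v))], which are uniformly continuous there once [r] is
so large that [g] has no zero on the circle of radius [r]. *)
Lemma radial_limit_uniformly_continuous g q :
  (forall z, continuous g z) -> (exists r0, forall z, r0 < Cmod z -> g z <> RtoC 0) ->
  uniform_radial_limit (fun r v => direction (g (RtoC r * v)%C)) q ->
  forall eps, 0 < eps -> exists delta, 0 < delta /\ forall v w,
    Cmod v = 1 -> Cmod w = 1 -> Cmod (w - v)%C < delta -> Cmod (q w - q v)%C < eps.
Proof.
intros Hg [ra Hra] Hq eps Heps.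
destruct (Hq (eps / 3) ltac:(lra)) as [rb Hrb].
set (r := Rmax 1 (Rmax ra rb + 1)).
assert (Hr : 1 <= r /\ ra < r /\ rb < r).
{ unfold r; pose proof (Rmax_l 1 (Rmax ra rb + 1)); pose proof (Rmax_r 1 (Rmax ra rb + 1)).
  pose proof (Rmax_l ra rb); pose proof (Rmax_r ra rb); lra. }
clearbody r.
destruct (uniformly_continuous_on_compact (fun v => Cmod v = 1)
  (fun v => direction (g (RtoC r * v)%C)) 1 (closed_circle 1)) with (eps := eps / 3)
  as [d [Hd Hd1]].
- intros v Hv; lra.
- intros v Hv; apply continuous_direction.
  + apply (continuous_comp (fun v => RtoC r * v)%C g); [| apply Hg].
    apply continuous_RtoC_mult; [apply continuous_const | apply continuous_id].
  + apply Hra; rewrite Cmod_mult, Cmod_R, Rabs_pos_eq, Hv by lra; lra.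
- lra.
- exists d; split; [exact Hd |]; intros v w Hv Hw Hvw.
  specialize (Hd1 v w Hv Hvw).
  assert (h1 := Hrb r v ltac:(lra) Hv); assert (h2 := Hrb r w ltac:(lra) Hw).
  cbv beta in h1, h2, Hd1.
  set (a := direction (g (RtoC r * v)%C)) in *; set (b := direction (g (RtoC r * w)%C)) in *.
  (* Three errors of [eps / 3]. *)
  replace (q w - q v)%C with (- (b - q w) + (b - a) + (a - q v))%C by ring.
  eapply Rle_lt_trans; [apply Cmod_triangle |].
  pose proof (Cmod_triangle (- (b - q w)) (b - a)) as h3; rewrite Cmod_opp in h3. lra.
Qed.

(** Points at distance at most [B] have nearly the same direction when they are far
away, hence nearly the same [q], which is nearly the direction of [g]. *)
Lemma field_aligned_far_away g q B :
  (forall z, continuous g z) -> (exists r0, forall z, r0 < Cmod z -> g z <> RtoC 0) ->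
  uniform_radial_limit (fun r v => direction (g (RtoC r * v)%C)) q -> 0 <= B ->
  exists r, 0 < r /\
    (forall z w, Cmod z = r -> Cmod (w - z)%C <= B -> 0 < dot (g w) (g z)) /\
    (forall z, Cmod z = r -> 0 < dot (g z) (q (direction z))).
Proof.
intros Hg Hinf Hq HB.
destruct (radial_limit_uniformly_continuous g q Hg Hinf Hq (1 / 3) ltac:(lra)) as [d [Hd Hqd]].
destruct Hinf as [ra Hra].
destruct (radial_limit_direction g q Hq (1 / 3) ltac:(lra)) as [rb Hrb].
(* [2 * B / d < r] keeps the rotation [2 * B / r] of [direction_near] below [d]. *)
assert (Hmax : exists r, 0 < r - B /\ ra < r - B /\ rb < r - B /\ 2 * B / d < r).
{ exists (Rabs ra + Rabs rb + 2 * B / d + B + 1).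
  assert (0 <= 2 * B / d) by (apply Rmult_le_pos; [lra | now apply Rlt_le, Rinv_0_lt_compat]).
  pose proof (Rle_abs ra); pose proof (Rle_abs rb).
  pose proof (Rabs_pos ra); pose proof (Rabs_pos rb); lra. }
destruct Hmax as [r [h0 [h1 [h2 h3]]]].
assert (Hfar : forall w, r - B <= Cmod w -> w <> RtoC 0 /\ g w <> RtoC 0 /\
  Cmod (direction (g w) - q (direction w))%C < 1 / 3).
{ intros w Hw.
  assert (w0 : w <> RtoC 0) by (apply Cmod_gt_0; lra).
  split; [exact w0 |]; split; [apply Hra; lra | apply Hrb; [lra | exact w0]]. }
exists r; split; [lra |]; split.
- intros z w Hz Hw.
  destruct (Hfar z ltac:(lra)) as [z0 [gz Ez]].
  assert (Hwr : r - B <= Cmod w).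
  { assert (Cmod z <= Cmod w + Cmod (w - z)%C); [| lra].
    replace z with (w + - (w - z))%C at 1 by ring.
    eapply Rle_trans; [apply Cmod_triangle |]; rewrite Cmod_opp; lra. }
  destruct (Hfar w Hwr) as [w0 [gw Ew]].
  apply dot_pos_of_directions; [exact gw | exact gz |].
  assert (Hdir : Cmod (direction w - direction z)%C < d).
  { eapply Rle_lt_trans; [apply (direction_near z w B r); auto; lra |].
    apply (Rmult_lt_reg_r r); [lra |].
    apply (Rmult_lt_compat_r d) in h3; [| exact Hd].
    replace (2 * B / d * d) with (2 * B) in h3 by (field; lra).
    replace (2 * B / r * r) with (2 * B) by (field; lra). lra. }
  assert (Hqq := Hqd (direction z) (direction w) (Cmod_direction z z0) (Cmod_direction w w0) Hdir).
  replace (direction (g w) - direction (g z))%C with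
    ((direction (g w) - q (direction w)) + (q (direction w) - q (direction z))
      + - (direction (g z) - q (direction z)))%C by ring.
  eapply Rle_lt_trans; [apply Cmod_triangle |]; rewrite Cmod_opp.
  pose proof (Cmod_triangle (direction (g w) - q (direction w))
    (q (direction w) - q (direction z))); lra.
- intros z Hz; destruct (Hfar z ltac:(lra)) as [z0 [gz Ez]].
  rewrite (direction_polar (g z) gz), dot_real_mult_l.
  apply Rmult_lt_0_compat; [now apply Cmod_gt_0 |].
  apply dot_pos_of_close; [now apply Cmod_direction |].
  replace (q (direction z) - direction (g z))%C
    with (- (direction (g z) - q (direction z)))%C by ring.
  rewrite Cmod_opp; lra.
Qed.

(** * Existence of a periodic solution *)

Theorem corollary1p1
  (T : R) (hT : 0 < T)
  (p : R -> C) (hpc : forall t : R, continuous p t) (hpT : periodic T p)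
  (G : C -> R) (hG : continuously_differentiable G)
  (g : C -> C) (hg : forall z : C, g z = gradient G z)
  (hinf : exists r0 : R, forall z : C, r0 < Cmod z -> g z <> average T p)
  (q : C -> C)
  (hq : uniform_radial_limit
          (fun (r : R) (v : C) =>
             direction (g (RtoC r * v)%C - average T p)%C) q)
  (hq0 : forall v : C, Cmod v = 1 -> q v <> RtoC 0)
  (hI : winding_number (fun theta : R => q (cis theta)) (RtoC 0) <> 0%Z) :
  exists u : R -> C, is_periodic_solution T (gradient G) p u.
Proof.
set (pb := average T p) in *.
set (g0 := fun z => (gradient G z - pb)%C).
assert (E : forall z, (g z - pb)%C = g0 z) by (intros z; unfold g0; now rewrite hg).
assert (Hg0 : forall z, continuous g0 z).
{ intros z; apply continuous_Cminus; [apply hG | apply continuous_const]. }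
assert (Hinf : exists r0, forall z, r0 < Cmod z -> g0 z <> RtoC 0).
{ destruct hinf as [r0 Hr0]; exists r0; intros z Hz h; apply (Hr0 z Hz).
  rewrite <- E in h; replace (g z) with ((g z - pb) + pb)%C by ring; rewrite h; ring. }
assert (Hq : uniform_radial_limit (fun r v => direction (g0 (RtoC r * v)%C)) q).
{ intros eps Heps; destruct (hq eps Heps) as [r0 Hr0]; exists r0; intros r v Hr Hv.
  specialize (Hr0 r v Hr Hv); cbv beta in Hr0; now rewrite E in Hr0. }
set (p0 := fun t => (p t - pb)%C).
assert (Hp0 : forall t, continuous p0 t).
{ intros t; apply continuous_Cminus; [apply hpc | apply continuous_const]. }
assert (Hp0T : periodic T p0) by (intros t; unfold p0; now rewrite hpT).
destruct (periodic_bounded T p0 hT Hp0T Hp0) as [P [HP0 HP]].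
destruct (periodic_primitive T p0 P hT Hp0T Hp0 HP (RInt_minus_average T p hT hpc))
  as [Pi [HPiT [HPid HPiL]]].
destruct (field_aligned_far_away g0 q (T * (P + 1) / 2) Hg0 Hinf Hq) as [r [Hr [Hdot Hdotq]]].
{ assert (0 <= T * (P + 1)) by (apply Rmult_le_pos; lra); lra. }
assert (Hmod : forall t, Cmod (RtoC r * cis t)%C = r).
{ intros t; rewrite Cmod_mult, Cmod_cis, Cmod_R, Rabs_pos_eq; lra. }
assert (HW : ~ is_winding_number (fun t => g0 (RtoC r * cis t)%C) (RtoC 0) 0).
{ intros W; apply hI, winding_number_eq.
  refine (winding_number_acute _ _ 0 _ _ _ _ _ W).
  - intros t _; apply (continuous_comp (fun t => RtoC r * cis t)%C g0); [| apply Hg0].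
    apply continuous_RtoC_mult; [apply continuous_const |].
    apply continuous_cis, continuous_id.
  - intros t _; apply (filterlim_Cmod (locally t) (fun s => q (cis s)) (q (cis t))).
    intros eps Heps.
    destruct (radial_limit_uniformly_continuous g0 q Hg0 Hinf Hq eps Heps) as [d [Hd Hqd]].
    generalize (proj1 (filterlim_Cmod (locally t) cis (cis t))
      (continuous_cis (fun s => s) t (continuous_id t)) d Hd).
    apply filter_imp; intros s Hs; apply Hqd; auto using Cmod_cis.
  - now rewrite cis_closed.
  - now rewrite cis_closed.
  - intros t _; specialize (Hdotq _ (Hmod t)).
    replace (direction (RtoC r * cis t)%C) with (cis t) in Hdotq; [exact Hdotq |].
    unfold direction; rewrite Hmod; field; intros h; apply RtoC_inj in h; lra. }
destruct (periodic_euler_orbits T (fun z => G z - dot pb z) g0 Pi P r) as [A [N0 Horb]]; auto.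
{ lra. }
{ exact (gradient_mean_value G pb hG). }
destruct (euler_limit T g0 Pi p0 P A N0) as [u [HuT Hu]]; auto; [lra |].
exists u, (fun t => p t - gradient G (u t))%C; split; [| split; [| split; [| exact HuT]]].
- intros t; specialize (Hu t).
  replace (p t - gradient G (u t))%C with (p0 t - g0 (u t))%C by (unfold p0, g0; ring).
  exact Hu.
- intros t; apply continuous_Cminus; [apply hpc |].
  apply (continuous_comp u (gradient G)); [| apply hG].
  apply (ex_derive_continuous (K := R_AbsRing) (V := C_R_NormedModule)).
  eexists; apply Hu.
- intros t; ring.
Qed.
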